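(* Let $\alpha, \beta \in \bar{\mathbb{Q}} \setminus \{0,1\}$ be such that $\rho(\alpha) \neq \rho(\beta)$. Then \[ T(\alpha,\beta) \subseteq \{\alpha,\beta\}. \] In particular, $T(\alpha,\beta)$ is finite and effectively computable.
   Context: For $\lambda \in \mathbb{C}\setminus\{0,1\}$ let $E_\lambda \colon y^2 = x(x-1)(x-\lambda)$ (Legendre family of elliptic curves). For $\alpha \in \mathbb{C}\setminus\{0,1\}$ let $P_\alpha(\lambda)$ be a point on $E_\lambda$ with $x$-coordinate $\alpha$ (well defined up to sign), and set $T(\alpha) = \{\lambda \in \mathbb{C}\setminus\{0,1\} : P_\alpha(\lambda) \text{ is a torsion point of } E_\lambda\}$ and $T(\alpha,\beta) = T(\alpha)\cap T(\beta)$. If $\alpha$ is algebraic over $\mathbb{Q}$, then $T(\alpha)\subseteq\bar{\mathbb{Q}}$, where $\bar{\mathbb{Q}}\subseteq\mathbb{C}$ is the algebraic closure of $\mathbb{Q}$. Fix an embedding $i \colon \bar{\mathbb{Q}} \hookrightarrow \bar{\mathbb{Q}}_2$ and let $Z = \{\alpha\in\bar{\mathbb{Q}} : i(\alpha) \text{ is integral}\}$. Let $\rho\colon \bar{\mathbb{Q}} \hookrightarrow \mathbb{P}^1(\bar{\mathbb{Q}}_2) \to \mathbb{P}^1(\bar{\mathbb{F}}_2)$ be the natural reduction map (so $\rho(\alpha)=\infty$ iff $\alpha\notin Z$, and for $\alpha \in Z$, $\rho(\alpha)$ is the residue class of $i(\alpha)$ in the residue field $\bar{\mathbb{F}}_2$).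 ''Effectively computable'' means that there is an algorithm determining the set $T(\alpha,\beta)$ from $\alpha,\beta$. *)

(* Defs.v *)
From HB Require Import structures.
From mathcomp Require Import all_boot all_order all_algebra all_field.
From mathcomp Require Import complex.
From mathcomp Require Import boolp classical_sets cardinality reals.

Set Implicit Arguments.
Unset Strict Implicit.
Unset Printing Implicit Defensive.

Import Order.TTheory GRing.Theory Num.Theory.
Local Open Scope ring_scope.
Local Open Scope quotient_scope.

Section Legendre.
Variable F : fieldType.

Inductive legendre_point := Infty | Affine of F & F.

Definition on_legendre (l : F) (P : legendre_point) : Prop :=
  match P with
  | Infty => True
  | Affine x y => y ^+ 2 = x * (x - 1) * (x - l)
  end.

(* Chord-tangent law on y^2 = x^3 - (1 + l) x^2 + l x; only meaningful for
   points on the curve.  A line of slope m meets the curve in three points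
   whose abscissae have sum m^2 + 1 + l. *)
Definition legendre_add (l : F) (P Q : legendre_point) : legendre_point :=
  match P, Q with
  | Infty, _ => Q
  | _, Infty => P
  | Affine x1 y1, Affine x2 y2 =>
      if (x1 == x2) && (y1 == - y2) then Infty else
      let m := if x1 == x2
               then (x1 ^+ 2 *+ 3 - (1 + l) * x1 *+ 2 + l) / (y1 *+ 2)
               else (y2 - y1) / (x2 - x1) in
      let x3 := m ^+ 2 + 1 + l - x1 - x2 in
      Affine x3 (m * (x1 - x3) - y1)
  end.

Definition legendre_mul (l : F) (n : nat) (P : legendre_point) : legendre_point :=
  iter n (legendre_add l P) Infty.

Definition torsion_point (l : F) (P : legendre_point) : Prop :=
  on_legendre l P /\ exists n, (0 < n)%N /\ legendre_mul l n P = Infty.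

(* The two points with abscissa a are opposite to each other, so it does not
   matter which of them is taken. *)
Definition torsion_params (a : F) : set F :=
  [set l | [/\ l != 0, l != 1 & exists y, torsion_point l (Affine a y)]].

Definition simultaneous_torsion (a b : F) : set F :=
  (torsion_params a `&` torsion_params b)%classic.

End Legendre.
Arguments Infty {F}.

Section AlgebraicNumbers.
Variable R : realType.

Definition algebraic_number : {pred R[i]} :=
  fun z => `[< algebraicOver (@ratr R[i]) z >].

Lemma algebraic_number_divring : divring_closed algebraic_number.
Proof.
split=> [|x y /asboolP hx /asboolP hy|x y /asboolP hx /asboolP hy];
  apply/asboolP.
- exact: algebraic1.
- exact: algebraic_sub.
- exact: algebraic_div.
Qed.
HB.instance Definition _ :=
  GRing.isDivringClosed.Build _ algebraic_number algebraic_number_divring.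

Record Qbar := MkQbar { Qval :> R[i]; _ : Qval \in algebraic_number }.

HB.instance Definition _ := [isSub for Qval].
HB.instance Definition _ := [Choice of Qbar by <:].
HB.instance Definition _ := [SubChoice_isSubComUnitRing of Qbar by <:].
HB.instance Definition _ := [SubComUnitRing_isSubIntegralDomain of Qbar by <:].
HB.instance Definition _ := [SubIntegralDomain_isSubField of Qbar by <:].

End AlgebraicNumbers.

Section AbsoluteValue.
Variable R : realType.

Record absolute_value (F : fieldType) := AbsoluteValue {
  absv :> F -> R;
  absv_ge0 : forall x, 0 <= absv x;
  absv_eq0 : forall x, absv x = 0 <-> x = 0;
  absvM : forall x y, absv (x * y) = absv x * absv y;
  absvD : forall x y, absv (x + y) <= Num.max (absv x) (absv y)
}.

Definition padic_abs (p : nat) (q : rat) : R :=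
  if q == 0 then 0 else
  p%:R ^+ logn p `|denq q|%N / p%:R ^+ logn p `|numq q|%N.

(* (K, v) is a completion of the rationals for the p-adic absolute value;
   this determines (K, v) up to a unique isomorphism. *)
Definition is_Qp (p : nat) (K : fieldType) (v : absolute_value K) : Prop :=
  [/\ forall q : rat, v (ratr q) = padic_abs p q,
      forall (x : K) (e : R), 0 < e -> exists q : rat, v (x - ratr q) < e
    & forall u : nat -> K,
        (forall e : R, 0 < e -> exists N, forall m n,
           (N <= m)%N -> (N <= n)%N -> v (u m - u n) < e) ->
        exists x, forall e : R, 0 < e -> exists N, forall n,
           (N <= n)%N -> v (u n - x) < e].

(* The extension w of v to an algebraic closure of the complete field K exists
   and is unique. *)
Definition is_Qp_closure (K : fieldType) (v : absolute_value K)
    (L : closedFieldType) (j : {rmorphism K -> L}) (w : absolute_value L) :=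
  (forall z : L, algebraicOver j z) /\ (forall x : K, w (j x) = v x).

Section Residue.
Variables (F : fieldType) (v : absolute_value F).

Lemma absv0 : v 0 = 0.
Proof. exact/absv_eq0. Qed.

Lemma absv1 : v 1 = 1.
Proof.
have v1 : v 1 != 0 by apply/eqP => /absv_eq0 /eqP; rewrite oner_eq0.
by apply: (mulfI v1); rewrite -absvM !mulr1.
Qed.

Lemma absvN x : v (- x) = v x.
Proof.
have vN1 : v (- 1) = 1.
  apply/eqP; rewrite -(@pexpr_eq1 _ _ 2%N) ?absv_ge0 //.
  by rewrite expr2 -absvM mulrNN mulr1 absv1.
by rewrite -mulN1r absvM vN1 mul1r.
Qed.

Definition integral : {pred F} := fun x => v x <= 1.

Lemma integral_subring : subring_closed integral.
Proof.
split=> [|x y hx hy|x y hx hy]; rewrite unfold_in.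
- by rewrite absv1.
- by apply: le_trans (absvD v x (- y)) _; rewrite ge_max absvN; apply/andP.
- by rewrite absvM mulr_ile1 ?absv_ge0.
Qed.
HB.instance Definition _ :=
  GRing.isSubringClosed.Build _ integral integral_subring.

Record integers := MkIntegers {
  integers_val :> F;
  _ : integers_val \in integral
}.

HB.instance Definition _ := [isSub for integers_val].
HB.instance Definition _ := [Choice of integers by <:].
HB.instance Definition _ := [SubChoice_isSubComNzRing of integers by <:].

Definition in_maximal_ideal : integers -> bool :=
  fun x => v (integers_val x) < 1.

Lemma maximal_ideal_closed : idealr_closed in_maximal_ideal.
Proof.
split=> [||a x y].
- by rewrite unfold_in /in_maximal_ideal /= absv0 ltr01.
- by rewrite unfold_in /in_maximal_ideal /= absv1 ltxx.
rewrite !unfold_in /in_maximal_ideal => hx hy.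
apply: le_lt_trans (absvD v _ _) _; rewrite gt_max hy andbT /= absvM.
by apply: le_lt_trans hx; rewrite ler_piMl ?absv_ge0 //; case: a.
Qed.
HB.instance Definition _ :=
  isIdealr.Build integers in_maximal_ideal maximal_ideal_closed.

Definition maximal_ideal : idealr integers :=
  Idealr.clone _ in_maximal_ideal _.

Definition residue_field := {ideal_quot maximal_ideal}.

(* The reduction map to the projective line over the residue field, restricted
   to affine points; None is the point at infinity. *)
Definition reduction (x : F) : option residue_field :=
  omap \pi_residue_field (insub x : option integers).

End Residue.
End AbsoluteValue.

(* While-programs over a field F: registers hold elements of F, the primitive
   operations are the field operations and the test for zero, and the only
   constant is 1.  With F = Qbar, where the primitive operations are effective
   for exact representations of algebraic numbers, these programs are
   algorithms on algebraic numbers (registers holding natural numbers provide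
   the usual counter machines). *)
Inductive expr :=
| Reg of nat
| One
| Add of expr & expr
| Opp of expr
| Mul of expr & expr
| Inv of expr.

Inductive cmd :=
| Skip
| Assign of nat & expr
| Seq of cmd & cmd
| IfZero of expr & cmd & cmd
| WhileNonzero of expr & cmd.

Section Programs.
Variable F : fieldType.
Implicit Types (s : nat -> F) (e : expr) (c : cmd).

Fixpoint eval s e : F :=
  match e with
  | Reg k => s k
  | One => 1
  | Add e1 e2 => eval s e1 + eval s e2
  | Opp e1 => - eval s e1
  | Mul e1 e2 => eval s e1 * eval s e2
  | Inv e1 => (eval s e1)^-1
  end.

Definition upd s k x : nat -> F := fun m => if m == k then x else s m.

(* exec c s s' : started in s, the program c halts in s'. *)
Inductive exec : cmd -> (nat -> F) -> (nat -> F) -> Prop :=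
| ExecSkip s : exec Skip s s
| ExecAssign s k e : exec (Assign k e) s (upd s k (eval s e))
| ExecSeq s1 s2 s3 c1 c2 :
    exec c1 s1 s2 -> exec c2 s2 s3 -> exec (Seq c1 c2) s1 s3
| ExecIfTrue s s' e c1 c2 :
    eval s e = 0 -> exec c1 s s' -> exec (IfZero e c1 c2) s s'
| ExecIfFalse s s' e c1 c2 :
    eval s e <> 0 -> exec c2 s s' -> exec (IfZero e c1 c2) s s'
| ExecWhileStop s e c : eval s e = 0 -> exec (WhileNonzero e c) s s
| ExecWhileStep s1 s2 s3 e c :
    eval s1 e <> 0 -> exec c s1 s2 -> exec (WhileNonzero e c) s2 s3 ->
    exec (WhileNonzero e c) s1 s3.

(* On input a, b in registers 0 and 1 (all others 0), c halts with the number n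
   of listed elements in register 0 and a list of the elements of A in
   registers 1, ..., n. *)
Definition computes_set c (a b : F) (A : set F) : Prop :=
  exists s n,
    [/\ exec c (nth 0 [:: a; b]) s, s 0%N = n%:R
      & A = [set x | exists2 k, (k < n)%N & x = s k.+1]%classic].

End Programs.

(* Main.v *)
Require Import Defs.
From HB Require Import structures.
From mathcomp Require Import all_boot all_order all_algebra all_field.
From mathcomp Require Import complex.
From mathcomp Require Import boolp classical_sets cardinality reals.
From mathcomp Require Import ring zify.

(** Write E_l for the curve y^2 = x(x - 1)(x - l) and fix an absolute value w
    with w 2 < 1 on the algebraic numbers, pulled back from the closure of Q_2.

    Containment.  On E_l one has x(2P) = (x^2 - l)^2 / (4 x (x - 1)(x - l)).
    Since 4 is small, doubling pushes points towards infinity: once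
    w(x) > 1 and w(x) > w(l), each further doubling multiplies w(x) by
    1 / w(4), so the points 2^n P are pairwise distinct and P is not torsion.
    Inspecting the first doubling, a torsion point of abscissa a outside
    {0, 1, l} must satisfy either w(a), w(l) <= 1 and w(a^2 - l) < 1, or
    w(a), w(l) > 1 ([torsion_congruence]).  If l is such a parameter for both
    a and b, then either a^2 and b^2 have the residue of l, so (a - b)^2
    reduces to 0, or a and b both reduce to infinity; in both cases the
    reductions of a and b agree ([common_parameter]).

    A parameter l is a priori only a complex number.  That 2^m P = 2^n P is
    a polynomial identity in l, whose polynomial does not vanish identically
    because the expansion argument applies to it at l = 0 or l = 1; hence l
    is algebraic ([torsion_params_algebraic]).

    All this uses that n |-> nP is compatible with addition, that is, the
    associativity of the chord-tangent law.  It is obtained from the ideals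
    of points in the coordinate ring F[x] + F[x] y: the product of the ideals
    of three collinear points is principal, a point and its opposite cancel,
    and no single point is principal ([principal1], [principal2]), because
    the norm A^2 - B^2 c of A + B y never has degree 1.

    Computability.  It remains to decide whether b is the abscissa of a
    torsion point P on E_a, and the same with a and b exchanged.  Torsion is
    found by enumerating multiples.  For the opposite outcome let S be the
    ring generated by a and by the abscissae x(nP).  If P is torsion, then
    all these numbers are integral for w, and 1/2 is not in S.  If P is not
    torsion, then 1/2 is in S ([nontorsion_half]): S has finite rank, so if 2
    is not a unit, S / 2^N S is finite and two abscissae x(mP), x(nP) agree
    modulo 2^N; expressing (y(mP) -+ y(nP))^2 through x((n +- m)P) and then
    using x(2mP) shows that the nonzero number 16 a^2 (1 - a)^4 is divisible
    by 2^N in S, for every N, which is impossible.  So a program that, side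
    by side, looks for a coincidence of abscissae and enumerates S in search
    of 1/2 always stops with the right answer. *)

Set Implicit Arguments.
Unset Strict Implicit.
Unset Printing Implicit Defensive.

Import Order.TTheory GRing.Theory Num.Theory.
Local Open Scope ring_scope.

(** * The coordinate ring of a cubic and products of ideals of points *)

(** The pair (A, B) stands for A + B y in F[x, y] / (y^2 - c).  The polynomial c
    occurs only in the multiplication, but it has to be a parameter of the type
    for the ring structure to be found from the type. *)
Definition coord_ring (F : fieldType) (c : {poly F}) := ({poly F} * {poly F})%type.

Section CoordinateRing.
Variables (F : fieldType) (c : {poly F}).

HB.instance Definition _ := GRing.Zmodule.copy (coord_ring c) ({poly F} * {poly F})%type.

Definition coord_mul (f g : coord_ring c) : coord_ring c :=
  (f.1 * g.1 + f.2 * g.2 * c, f.1 * g.2 + f.2 * g.1).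

Fact coord_mulA : associative coord_mul.
Proof. by move=> [a b] [a' b'] [a2 b2]; congr pair => /=; ring. Qed.
Fact coord_mulC : commutative coord_mul.
Proof. by move=> [a b] [a' b']; congr pair => /=; ring. Qed.
Fact coord_mul1 : left_id ((1, 0) : coord_ring c) coord_mul.
Proof. by move=> [a b]; congr pair => /=; ring. Qed.
Fact coord_mulD : left_distributive coord_mul +%R.
Proof. by move=> [a b] [a' b'] [a2 b2]; congr pair => /=; ring. Qed.
Fact coord_1neq0 : ((1, 0) : coord_ring c) != 0.
Proof. by apply/eqP => -[/eqP]; rewrite oner_eq0. Qed.

HB.instance Definition _ := GRing.Zmodule_isComNzRing.Build (coord_ring c)
  coord_mulA coord_mulC coord_mul1 coord_mulD coord_1neq0.

Definition inj_poly (p : {poly F}) : coord_ring c := (p, 0).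
Fact inj_poly_additive : zmod_morphism inj_poly.
Proof. by move=> p q; congr pair; rewrite /= subr0. Qed.
Fact inj_poly_monoid : monoid_morphism inj_poly.
Proof. by split=> // p q; congr pair => /=; ring. Qed.
HB.instance Definition _ := GRing.isZmodMorphism.Build _ _ inj_poly inj_poly_additive.
HB.instance Definition _ := GRing.isMonoidMorphism.Build _ _ inj_poly inj_poly_monoid.

Definition Yc : coord_ring c := (0, 1).
Lemma Yc2 : Yc ^+ 2 = inj_poly c.
Proof. by rewrite expr2; congr pair => /=; ring. Qed.

Definition coord_norm (f : coord_ring c) : {poly F} := f.1 ^+ 2 - f.2 ^+ 2 * c.
Definition coord_conj (f : coord_ring c) : coord_ring c := (f.1, - f.2).

Lemma coord_normM (f g : coord_ring c) : coord_norm (f * g) = coord_norm f * coord_norm g.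
Proof. by rewrite /coord_norm /=; ring. Qed.

Lemma coord_norm_inj_poly p : coord_norm (inj_poly p) = p ^+ 2.
Proof. by rewrite /coord_norm /=; ring. Qed.

Fact coord_conj_additive : zmod_morphism coord_conj.
Proof. by move=> f g; congr pair => /=; ring. Qed.
Fact coord_conj_monoid : monoid_morphism coord_conj.
Proof. by split=> [|f g]; congr pair => /=; ring. Qed.
HB.instance Definition _ := GRing.isZmodMorphism.Build _ _ coord_conj coord_conj_additive.
HB.instance Definition _ := GRing.isMonoidMorphism.Build _ _ coord_conj coord_conj_monoid.

Lemma coord_norm_conj f : coord_norm (coord_conj f) = coord_norm f.
Proof. by rewrite /coord_norm /=; ring. Qed.

Local Notation cst k := (inj_poly k%:P).
Local Notation Xc := (inj_poly 'X).

(** Membership in the product, over the points A of s, of the ideals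
    (x - A.1, y - A.2).  Products of ideals count a repeated point with
    multiplicity, with no appeal to orders of vanishing. *)
Fixpoint vanishes (s : seq (F * F)) (f : coord_ring c) : Prop :=
  if s is A :: s' then
    exists u v, [/\ vanishes s' u, vanishes s' v
                  & f = (Xc - cst A.1) * u + (Yc - cst A.2) * v]
  else True.

Lemma vanishesD s f g : vanishes s f -> vanishes s g -> vanishes s (f + g).
Proof.
elim: s f g => //= A s IH f g [u [v [hu hv ->]]] [u' [v' [hu' hv' ->]]].
by exists (u + u'), (v + v'); split; [exact: IH | exact: IH | ring].
Qed.

Lemma vanishesMl s h f : vanishes s f -> vanishes s (h * f).
Proof.
elim: s h f => //= A s IH h f [u [v [hu hv ->]]].
by exists (h * u), (h * v); split; [exact: IH | exact: IH | ring].
Qed.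

Lemma vanishesN s f : vanishes s f -> vanishes s (- f).
Proof. by rewrite -mulN1r; exact: vanishesMl. Qed.

Lemma vanishesS A s f : vanishes (A :: s) f -> vanishes s f.
Proof.
by move=> [u [v [hu hv ->]]]; apply: vanishesD; exact: vanishesMl.
Qed.

Lemma vanishes_cat s t f g :
  vanishes s f -> vanishes t g -> vanishes (s ++ t) (f * g).
Proof.
elim: s f => [|A s IH] f /=; first by move=> _; exact: vanishesMl.
move=> [u [v [hu hv ->]]] hg; exists (u * g), (v * g).
by split; [exact: IH | exact: IH | ring].
Qed.

Lemma vanishes_cons2 A B s f : vanishes (A :: B :: s) f -> vanishes (B :: A :: s) f.
Proof.
move=> /= [u [v [[u1 [u2 [h1 h2 ->]]] [v1 [v2 [h3 h4 ->]]] ->]]].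
exists ((Xc - cst A.1) * u1 + (Yc - cst A.2) * v1).
exists ((Xc - cst A.1) * u2 + (Yc - cst A.2) * v2).
split; [by exists u1, v1|by exists u2, v2|ring].
Qed.

Lemma vanishes_insert A s1 s2 f :
  vanishes (A :: s1 ++ s2) f <-> vanishes (s1 ++ A :: s2) f.
Proof.
elim: s1 f => [//|B s1 IH] f; split.
  move/vanishes_cons2 => [u [v [/IH hu /IH hv ->]]].
  by exists u, v.
move=> [u [v [/IH hu /IH hv ->]]]; apply: vanishes_cons2.
by exists u, v.
Qed.

(** Products of ideals commute. *)
Lemma vanishes_perm s t f : perm_eq s t -> vanishes s f -> vanishes t f.
Proof.
elim: s t f => [|A s IH] t f; first by rewrite perm_sym => /perm_nilP ->.
move=> pst; have At : A \in t by rewrite -(perm_mem pst) mem_head.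
case/splitPr: At pst => t1 t2.
rewrite perm_sym perm_catC cat_cons perm_cons perm_catC perm_sym => pst.
move=> [u [v [/(IH _ _ pst) hu /(IH _ _ pst) hv ->]]].
by apply/vanishes_insert; exists u, v.
Qed.

Definition on_curve (A : F * F) := A.2 ^+ 2 = c.[A.1].
Definition opp_pt (A : F * F) := (A.1, - A.2).

Lemma vanishes_conj s f : vanishes s f -> vanishes (map opp_pt s) (coord_conj f).
Proof.
elim: s f => //= A s IH f [u [v [/IH hu /IH hv ->]]].
exists (coord_conj u), (- coord_conj v); split=> //; first exact: vanishesN.
have -> : coord_conj ((Xc - cst A.1) * u + (Yc - cst A.2) * v) =
  (coord_conj Xc - coord_conj (cst A.1)) * coord_conj u +
  (coord_conj Yc - coord_conj (cst A.2)) * coord_conj v.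
  by ring.
have conj_poly p : coord_conj (inj_poly p) = inj_poly p by congr pair; rewrite /= oppr0.
rewrite !conj_poly.
have -> : coord_conj Yc = - Yc by congr pair; rewrite /= oppr0.
by rewrite /=; ring.
Qed.

(** The identity (y - A.2)(y + A.2) = (x - A.1) q, which drives all
    computations with the ideal of A, comes from this factorization; smoothness
    at a point with A.2 = 0 enters as q.[A.1] != 0. *)
Lemma factor_curve A : on_curve A ->
  exists q, [/\ c = A.2%:P ^+ 2 + ('X - A.1%:P) * q & q.[A.1] = c^`().[A.1]].
Proof.
move=> hA; have /factor_theorem[q hq] : root (c - (A.2 ^+ 2)%:P) A.1.
  by rewrite rootE !hornerE hA subrr.
have e : c = A.2%:P ^+ 2 + ('X - A.1%:P) * q.
  by rewrite -rmorphXn /= [_ * q]mulrC -hq; ring.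
exists q; split=> //; rewrite e -rmorphXn /= !derivE.
by rewrite !hornerE subrr mul0r addr0.
Qed.

(** The product of the ideals of two opposite points lies in the principal ideal
    of x - A.1, so such a pair can be divided out. *)
Lemma vanishes_cancel A s f : on_curve A -> vanishes (A :: opp_pt A :: s) f ->
  exists2 g, vanishes s g & f = (Xc - cst A.1) * g.
Proof.
move=> hA [u [v [/vanishesS hu [v1 [v2 [h1 h2 ->]]] ->]]].
have [q [hq _]] := factor_curve hA.
exists (u + (Yc - cst A.2) * v1 + inj_poly q * v2).
  by apply: vanishesD; [apply: vanishesD|]=> //; exact: vanishesMl.
have e : (Yc - cst A.2) * (Yc + cst A.2) = (Xc - cst A.1) * inj_poly q.
  by rewrite -subr_sqr Yc2 hq; ring.
rewrite /=; transitivity ((Xc - cst A.1) * u + (Xc - cst A.1) * (Yc - cst A.2) * v1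
   + (Yc - cst A.2) * (Yc + cst A.2) * v2); first by ring.
by rewrite e; ring.
Qed.

Definition divisor_poly (s : seq (F * F)) : {poly F} := \prod_(A <- s) ('X - A.1%:P).

(** The norm condition says that f has no zeros besides those imposed by the
    membership; it replaces the statement that f generates the product ideal. *)
Definition principal (s : seq (F * F)) :=
  exists f k, [/\ vanishes s f, k != 0 & coord_norm f = k%:P * divisor_poly s].

Lemma principal_perm s t : perm_eq s t -> principal s -> principal t.
Proof.
move=> pst [f [k [hf hk nf]]]; exists f, k; split=> //; first exact: vanishes_perm hf.
by rewrite nf /divisor_poly (perm_big _ pst).
Qed.

Lemma principal_cat s t : principal s -> principal t -> principal (s ++ t).
Proof.
move=> [f [k [hf hk nf]]] [g [k' [hg hk' ng]]]; exists (f * g), (k * k').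
split; [exact: vanishes_cat|by rewrite mulf_neq0|].
by rewrite coord_normM nf ng /divisor_poly big_cat /=; ring.
Qed.

Lemma principal_opp s : principal s -> principal (map opp_pt s).
Proof.
move=> [f [k [hf hk nf]]]; exists (coord_conj f), k; split=> //; first exact: vanishes_conj.
by rewrite coord_norm_conj nf /divisor_poly big_map.
Qed.

Lemma principal_cancel A s : on_curve A ->
  principal (A :: opp_pt A :: s) -> principal s.
Proof.
move=> hA [f [k [hf hk nf]]]; have [g hg fE] := vanishes_cancel hA hf.
exists g, k; split=> //.
have nX : 'X - A.1%:P != 0 :> {poly F} by rewrite polyXsubC_eq0.
apply: (mulfI (expf_neq0 2 nX)); rewrite -[LHS]mulr1.
move: nf; rewrite fE coord_normM -rmorphB coord_norm_inj_poly mulr1 => ->.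
by rewrite /divisor_poly !big_cons /=; ring.
Qed.

Arguments inj_poly : simpl never.
Arguments Yc : simpl never.

Hypothesis size_c : size c = 4%N.
Hypothesis two_neq0 : 2%:R != 0 :> F.
Hypothesis smooth : forall A, on_curve A -> A.2 = 0 -> c^`().[A.1] != 0.

(** For f = (A, B), A^2 has even degree and B^2 c odd degree at least 3, so their leading terms
    cannot cancel. *)
Lemma coord_norm_size (f : coord_ring c) : (size (coord_norm f) < 4)%N -> f.2 = 0.
Proof.
case: f => a b; rewrite /coord_norm /= => h; apply/eqP/negP => /negP b0.
have c0 : c != 0 by rewrite -size_poly_eq0 size_c.
have sb : size (b ^+ 2 * c) = ((size b).-1.*2 + 4)%N.
  rewrite size_mul ?expf_neq0 // size_c expr2 size_mul // -addnn.
  by case: (size b) (size_poly_gt0 b) => [|m]; rewrite b0 //= !addnS !addnE.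
have [a0|a0] := eqVneq a 0.
  by move: h; rewrite a0 expr0n /= sub0r size_polyN sb addnS ltnS ltnNge leq_addl.
have sa : size (a ^+ 2) = ((size a).-1.*2.+1)%N.
  rewrite expr2 size_mul // -addnn.
  by case: (size a) (size_poly_gt0 a) => [|m]; rewrite a0 //= addnS.
have : (4 <= maxn (size (a ^+ 2)%R) (size (b ^+ 2 * c)%R))%N.
  by rewrite leq_max sb leq_addl orbT.
case: (ltngtP (size (a ^+ 2)) (size (b ^+ 2 * c))) => hs.
- by rewrite leqNgt => /negP[]; move: h; rewrite addrC size_polyDl size_polyN.
- by rewrite leqNgt => /negP[]; move: h; rewrite size_polyDl ?size_polyN.
- by move: hs => /(congr1 odd); rewrite sa sb /= oddD !odd_double.
Qed.

(** By [coord_norm_size] a norm of degree 1 would be the square of a polynomial. *)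
Lemma principal1 A : ~ principal [:: A].
Proof.
move=> [f [k [_ k0]]]; rewrite /divisor_poly big_seq1 => nf.
have s2 : size (coord_norm f) = 2%N.
  by rewrite nf mul_polyC size_scale // size_XsubC.
have f2 : f.2 = 0 by apply: coord_norm_size; rewrite s2.
have : coord_norm f = f.1 ^+ 2 by rewrite /coord_norm f2 expr0n /= mul0r subr0.
move/(congr1 (size : {poly F} -> nat)); rewrite s2 expr2.
have [->|f0] := eqVneq f.1 0; first by rewrite mul0r size_poly0.
rewrite size_mul //; case: (size f.1) => // m; rewrite addnS /= addSn => -[].
by move/(congr1 odd); rewrite addnn odd_double.
Qed.

(** A generator has a norm of degree 2, so it is a polynomial in x alone, and its
    square being the norm forces the two abscissae to agree.  The remaining case
    B = A with A.2 != 0 would make x - A.1 vanish doubly at A; multiplying by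
    (y + A.2)^2, doubly vanishing at the opposite point, and cancelling twice
    gives (x - A.1)(y + A.2)^2 divisible by (x - A.1)^2, which the coefficient
    2 A.2 of y in (y + A.2)^2 rules out. *)
Lemma principal2 A B : on_curve A -> on_curve B -> principal [:: A; B] ->
  B = opp_pt A.
Proof.
move=> hA hB [f [k [hf k0]]]; rewrite /divisor_poly big_cons big_seq1 => nf.
have nX z : 'X - z%:P != 0 :> {poly F} by rewrite polyXsubC_eq0.
have f2 : f.2 = 0.
  apply: coord_norm_size; rewrite nf mul_polyC size_scale // size_mul //.
  by rewrite !size_XsubC.
have nf1 : f.1 ^+ 2 = k%:P * (('X - A.1%:P) * ('X - B.1%:P)).
  by rewrite -nf /coord_norm f2 expr0n /= mul0r subr0.
have /factor_theorem[q qE] : root f.1 A.1.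
  by rewrite rootE -sqrf_eq0 -horner_exp nf1 !hornerE /= subrr mulr0 mul0r.
have q2 : q ^+ 2 * ('X - A.1%:P) = k%:P * ('X - B.1%:P).
  apply: (mulfI (nX A.1)); transitivity (f.1 ^+ 2); first by rewrite qE; ring.
  by rewrite nf1; ring.
have xAB : A.1 = B.1.
  move/(congr1 (fun p => p.[A.1])): q2; rewrite !hornerE subrr mulr0.
  by move/esym/eqP; rewrite mulf_eq0 (negPf k0) /= subr_eq0 => /eqP.
have q2k : q ^+ 2 = k%:P by apply: (mulIf (nX A.1)); rewrite q2 xAB.
have q0 : q != 0.
  apply: contraNneq k0 => q0; move: q2k.
  by rewrite q0 expr0n /= => /esym/eqP; rewrite polyC_eq0.
have [e qC] : exists e, q = e%:P.
  exists q`_0; apply: size1_polyC.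
  move/(congr1 (size : {poly F} -> nat)): q2k.
  rewrite expr2 size_mul // size_polyC k0.
  by case: (size q) => // -[//|m]; rewrite addnS addSn.
have e0 : e != 0 by rewrite -polyC_eq0 -qC.
case: (eqVneq B.2 (- A.2)) => [yAB|yAB].
  by rewrite [B]surjective_pairing yAB -xAB.
have yAB' : B.2 = A.2.
  have : (B.2 + A.2) * (B.2 - A.2) = 0.
    by rewrite mulrC -subr_sqr hA hB xAB subrr.
  by move/eqP; rewrite mulf_eq0 addr_eq0 (negPf yAB) subr_eq0 => /eqP.
have eBA : B = A by rewrite [B]surjective_pairing yAB' -xAB -surjective_pairing.
have yA0 : A.2 != 0 by apply: contraNneq yAB => yA0; rewrite yAB' yA0 oppr0.
(* h vanishes at the opposite of A, so f h^2 can be cancelled twice. *)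
pose h : coord_ring c := Yc + cst A.2.
have hh : vanishes [:: opp_pt A] h.
  by exists 0, 1; split=> //=; rewrite /h !rmorphN; ring.
rewrite eBA in hf.
have fhh : vanishes [:: A; opp_pt A; A; opp_pt A] (f * (h * h)).
  apply: vanishes_perm (vanishes_cat hf (vanishes_cat hh hh)).
  by apply/permP => p /=; ring.
have [g hg] := vanishes_cancel hA fhh.
have [g' _ ->] := vanishes_cancel hA hg.
rewrite -!rmorphB => /(congr1 snd) /=.
rewrite f2 qE qC => E.
have : ('X - A.1%:P) * (('X - A.1%:P) * g'.2) = ('X - A.1%:P) * (e * A.2 *+ 2)%:P.
  transitivity (('X - (A.1)%:P) * (('X - (A.1)%:P) * g'.2 + 0 * g'.1) +
     0 * (('X - (A.1)%:P) * g'.1 + 0 * g'.2 * c)); first by ring.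
  by rewrite -E; ring.
move/(mulfI (nX _))/(congr1 (fun p => p.[A.1])).
rewrite !hornerE subrr mul0r => /esym/eqP.
by rewrite -mulr_natr !mulf_eq0 (negPf e0) (negPf yA0) (negPf two_neq0).
Qed.

(** The difference (x - A.1)(y + A.2) - (y - A.2)(x - A.1) is 2 A.2 (x - A.1), which
    settles the case A.2 != 0; if A.2 = 0, then y^2 = (x - A.1) q with q.[A.1] != 0. *)
Lemma principal_opp_pair A : on_curve A -> principal [:: A; opp_pt A].
Proof.
move=> hA; exists (Xc - cst A.1), 1; split; last 2 first.
- exact: oner_neq0.
- by rewrite -rmorphB coord_norm_inj_poly /divisor_poly big_cons big_seq1 mul1r.
have [q [hq qA]] := factor_curve hA.
have hX : vanishes [:: opp_pt A] (Xc - cst A.1).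
  by exists 1, 0; split=> //=; ring.
have hY : vanishes [:: opp_pt A] (Yc + cst A.2).
  by exists 0, 1; split=> //=; rewrite !rmorphN; ring.
have e : (Yc - cst A.2) * (Yc + cst A.2) = (Xc - cst A.1) * inj_poly q.
  by rewrite -subr_sqr Yc2 {1}hq; ring.
have [y0|y0] := eqVneq A.2 0.
  have d0 := smooth hA y0; rewrite -qA in d0.
  have /factor_theorem[k kE] : root (q - q.[A.1]%:P) A.1.
    by rewrite rootE !hornerE subrr.
  pose d := (q.[A.1])^-1.
  have dq : cst d * cst q.[A.1] = 1 by rewrite -!rmorphM /= mulVf.
  exists (- (cst d * inj_poly k * (Xc - cst A.1))), (cst d * (Yc + cst A.2)).
  split; [by apply/vanishesN/vanishesMl|exact: vanishesMl|].
  transitivity (- (cst d * (inj_poly k * (Xc - cst A.1))) * (Xc - cst A.1) +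
     cst d * ((Yc - cst A.2) * (Yc + cst A.2))); last by ring.
  have -> : inj_poly k * (Xc - cst A.1) = inj_poly q - cst q.[A.1].
    by rewrite -!rmorphB -rmorphM -kE.
  rewrite e; transitivity ((cst d * cst q.[A.1]) * (Xc - cst A.1)); last by ring.
  by rewrite dq mul1r.
pose d := (A.2 *+ 2)^-1.
have dy : cst d * (cst A.2 *+ 2) = 1.
  rewrite -rmorphMn -rmorphMn -rmorphM -rmorphM /= mulVf //.
  by rewrite -mulr_natr mulf_neq0.
exists (cst d * (Yc + cst A.2)), (- (cst d * (Xc - cst A.1))).
split; [exact: vanishesMl|by apply/vanishesN/vanishesMl|].
transitivity ((cst d * (cst A.2 *+ 2)) * (Xc - cst A.1)); last by ring.
by rewrite dy mul1r.
Qed.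

Lemma deriv_double_root (p q : {poly F}) x : p.[x] = 0 ->
  (p ^+ 2 + ('X - x%:P) * ('X - x%:P) * q)^`().[x] = 0.
Proof.
move=> px; rewrite expr2 !derivD !derivM !derivXsubC mul1r mulr1.
by rewrite !(hornerD, hornerM, hornerN, hornerX, hornerC) px; ring.
Qed.

Section Line.
Variables m k : F.
Let L : {poly F} := m%:P * 'X + k%:P.
Let pt x : F * F := (x, L.[x]).
Let w : coord_ring c := Yc - inj_poly L.

Let vanishes_line x : vanishes [:: pt x] w.
Proof.
exists (- cst m), 1; split=> //=; rewrite /w /L !hornerE.
by rewrite !rmorphD !rmorphM /=; ring.
Qed.

Let vanishes_abscissa x : vanishes [:: pt x] (Xc - cst x).
Proof. by exists 1, 0; split=> //=; ring. Qed.

Let line_conj : w * (w + inj_poly L *+ 2) = inj_poly (c - L ^+ 2).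
Proof. by rewrite rmorphB rmorphXn /= -Yc2 /w; ring. Qed.

(** Let J be the product of the three ideals, w = y - L and e = 2 m (x - x0) + w,
    where x0 is the repeated abscissa and y0 = L.[x0], so that w + 2 L = 2 y0 + e.  As
    w (2 y0 + e) and w e^2 both lie in J, so does 4 y0^2 w; and y0 != 0 because
    a smooth cubic has no double intersection with a non-vertical line at a
    point of ordinate 0. *)
Lemma line_vanishes_double x z :
  c - L ^+ 2 = ('X - x%:P) * ('X - x%:P) * ('X - z%:P) ->
  vanishes [:: pt x; pt x; pt z] w.
Proof.
move=> cL.
have cE : c = L ^+ 2 + ('X - x%:P) * ('X - x%:P) * ('X - z%:P) by rewrite -cL; ring.
have hx : on_curve (pt x).
  by rewrite /on_curve cE /= !hornerE subrr !mul0r addr0 expr2.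
have y0 : L.[x] != 0.
  apply/negP => /eqP y0; have /eqP[] := smooth hx y0.
  by rewrite cE /=; exact: deriv_double_root.
pose d := (L.[x] ^+ 2 *+ 4)^-1.
have dy : cst d * (cst L.[x] ^+ 2 *+ 4) = 1.
  rewrite -!rmorphXn -!rmorphMn -!rmorphM /= mulVf //.
  by rewrite -mulr_natr mulf_neq0 ?expf_neq0 // (natrM _ 2 2) mulf_neq0.
have LE : inj_poly L = cst L.[x] + cst m * (Xc - cst x).
  rewrite -rmorphB -rmorphM -rmorphD; congr inj_poly.
  by rewrite /L !hornerE rmorphD rmorphM /=; ring.
have PE : w * (w + inj_poly L *+ 2) = (Xc - cst x) * ((Xc - cst x) * (Xc - cst z)).
  by rewrite line_conj cL -!rmorphB -!rmorphM mulrA.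
have -> : w = cst d * (cst L.[x] *+ 2 - (cst m * (Xc - cst x) *+ 2 + w)) *
      ((Xc - cst x) * ((Xc - cst x) * (Xc - cst z))) +
    (cst d * cst m ^+ 2 *+ 4 * ((Xc - cst x) * ((Xc - cst x) * w)) +
    (cst d * cst m *+ 4 * ((Xc - cst x) * (w * w)) + cst d * (w * (w * w)))).
  rewrite -PE LE.
  transitivity ((cst d * (cst L.[x] ^+ 2 *+ 4)) * w); last by ring.
  by rewrite dy mul1r.
by do ?apply: vanishesD; apply: vanishesMl;
  apply: (@vanishes_cat [:: pt x]) => //; apply: (@vanishes_cat [:: pt x]).
Qed.

(** When the abscissae are distinct, Lagrange interpolation of the constant 1
    writes y - L as a combination of its products with two of the x - x_i. *)
Lemma line_principal x1 x2 x3 :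
  c - L ^+ 2 = ('X - x1%:P) * ('X - x2%:P) * ('X - x3%:P) ->
  principal [:: pt x1; pt x2; pt x3].
Proof.
move=> cL; exists w, (-1); split; last 2 first.
- by rewrite oppr_eq0 oner_eq0.
- rewrite /divisor_poly !big_cons big_nil /= mulr1 mulrA -cL /coord_norm /w /=.
  by rewrite polyCN; ring.
have [e12|n12] := eqVneq x1 x2.
  by rewrite -e12 in cL *; exact: line_vanishes_double.
have [e13|n13] := eqVneq x1 x3.
  apply: (@vanishes_perm [:: pt x1; pt x1; pt x2]).
    by rewrite -e13; apply/permP => p /=; ring.
  by apply: line_vanishes_double; rewrite cL -e13; ring.
have [e23|n23] := eqVneq x2 x3.
  apply: (@vanishes_perm [:: pt x2; pt x2; pt x1]).
    by rewrite -e23; apply/permP => p /=; ring.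
  by apply: line_vanishes_double; rewrite cL -e23; ring.
pose d1 := ((x1 - x2) * (x1 - x3))^-1; pose d2 := ((x2 - x1) * (x2 - x3))^-1.
pose d3 := ((x3 - x1) * (x3 - x2))^-1.
have s1 : d1 + d2 + d3 = 0.
  rewrite /d1 /d2 /d3; field.
  by rewrite !subr_eq0 n12 n13 n23 ![_ == x1]eq_sym ![x3 == _]eq_sym n12 n13 n23.
have s2 : d1 * (x2 + x3) + d2 * (x1 + x3) + d3 * (x1 + x2) = 0.
  rewrite /d1 /d2 /d3; field.
  by rewrite !subr_eq0 n12 n13 n23 ![_ == x1]eq_sym ![x3 == _]eq_sym n12 n13 n23.
have s3 : d1 * (x2 * x3) + d2 * (x1 * x3) + d3 * (x1 * x2) = 1.
  rewrite /d1 /d2 /d3; field.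
  by rewrite !subr_eq0 n12 n13 n23 ![_ == x1]eq_sym ![x3 == _]eq_sym n12 n13 n23.
have -> : w = cst d1 * (w * ((Xc - cst x2) * (Xc - cst x3))) +
  (cst d2 * ((Xc - cst x1) * (w * (Xc - cst x3))) +
   cst d3 * ((Xc - cst x1) * ((Xc - cst x2) * w))).
  transitivity ((cst (d1 + d2 + d3) * Xc ^+ 2 -
    cst (d1 * (x2 + x3) + d2 * (x1 + x3) + d3 * (x1 + x2)) * Xc +
    cst (d1 * (x2 * x3) + d2 * (x1 * x3) + d3 * (x1 * x2))) * w).
    by rewrite s1 s2 s3 /=; ring.
  by rewrite !(rmorphD, rmorphM) /=; ring.
by do ?apply: vanishesD; apply: vanishesMl;
  apply: (@vanishes_cat [:: pt x1]) => //; apply: (@vanishes_cat [:: pt x2]).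
Qed.
End Line.

End CoordinateRing.

(** * The group law on the Legendre curve *)

Section GroupLaw.
Variables (F : fieldType) (l : F).
Hypotheses (two_neq0 : 2%:R != 0 :> F) (l_neq0 : l != 0) (l_neq1 : l != 1).

Definition legendre_poly : {poly F} := 'X * ('X - 1) * ('X - l%:P).

Lemma horner_legendre_poly x : legendre_poly.[x] = x * (x - 1) * (x - l).
Proof. by rewrite /legendre_poly !hornerE. Qed.

Lemma size_legendre_poly : size legendre_poly = 4%N.
Proof.
have -> : legendre_poly = \prod_(x <- [:: 0; 1; l]) ('X - x%:P).
  by rewrite !big_cons big_nil polyC0 polyC1 subr0 mulr1 mulrA.
by rewrite size_prod_XsubC.
Qed.

Lemma legendre_poly_smooth (A : F * F) :
  on_curve legendre_poly A -> A.2 = 0 -> legendre_poly^`().[A.1] != 0.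
Proof.
case: A => x y; rewrite /on_curve /= horner_legendre_poly => + y0.
have -> : legendre_poly^`().[x] =
    (x - 1) * (x - l) + x * (x - l) + x * (x - 1).
  rewrite /legendre_poly -polyC1 !derivM derivX !derivXsubC.
  by rewrite !hornerE; ring.
rewrite y0 expr0n /= => /esym/eqP; rewrite !mulf_eq0 !subr_eq0.
case/orP => [/orP[]|] /eqP->.
- by rewrite !mul0r !addr0 sub0r mulNr mul1r opprB subr0.
- by rewrite subrr mul0r add0r mulr0 addr0 mul1r subr_eq0 eq_sym.
- by rewrite subrr !mulr0 !add0r mulf_neq0 ?subr_eq0.
Qed.

Definition legendre_opp (P : legendre_point F) : legendre_point F :=
  if P is Affine x y then Affine x (- y) else Infty.

Definition finite_part (P : legendre_point F) : seq (F * F) :=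
  if P is Affine x y then [:: (x, y)] else [::].

Local Notation on := (on_legendre l).
Local Notation add := (legendre_add l).
Local Notation prin := (principal legendre_poly).

Lemma on_legendre_opp P : on P -> on (legendre_opp P).
Proof. by case: P => //= x y; rewrite sqrrN. Qed.

Lemma legendre_oppK P : legendre_opp (legendre_opp P) = P.
Proof. by case: P => //= x y; rewrite opprK. Qed.

Lemma on_curveE x y : on (Affine x y) -> on_curve legendre_poly (x, y).
Proof. by rewrite /on_curve /= horner_legendre_poly. Qed.

(** The abscissa of the third intersection is dictated by the coefficient of X^2,
    which leaves a difference a1 X + a0.  It vanishes at x1; that a1 = 0 comes
    from the second point for a chord and from the slope for a tangent. *)
Lemma line_cubic x1 y1 x2 y2 m : on (Affine x1 y1) -> on (Affine x2 y2) ->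
    y2 = y1 + m * (x2 - x1) ->
    (x1 = x2 -> m * (y1 *+ 2) = x1 ^+ 2 *+ 3 - (1 + l) * x1 *+ 2 + l) ->
  let x3 := m ^+ 2 + 1 + l - x1 - x2 in
  legendre_poly - (m%:P * 'X + (y1 - m * x1)%:P) ^+ 2 =
    ('X - x1%:P) * ('X - x2%:P) * ('X - x3%:P).
Proof.
move=> /= h1 h2 y2E tangent.
set x3 := _ - x1 - x2; set k := y1 - m * x1.
pose a1 := l - m * k *+ 2 - (x1 * x2 + (x1 + x2) * x3).
pose a0 := x1 * x2 * x3 - k ^+ 2.
have a10 : a1 = 0.
  have [e|ne] := eqVneq x1 x2.
    transitivity (x1 ^+ 2 *+ 3 - (1 + l) * x1 *+ 2 + l - m * (y1 *+ 2)).
      by rewrite /a1 /x3 /k -e; ring.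
    by rewrite tangent // subrr.
  have ne' : x2 - x1 != 0 by rewrite subr_eq0 eq_sym.
  apply: (mulIf ne'); rewrite mul0r.
  transitivity (x2 * (x2 - 1) * (x2 - l) - (y1 + m * (x2 - x1)) ^+ 2
     - (x1 * (x1 - 1) * (x1 - l) - y1 ^+ 2)).
    by rewrite /a1 /x3 /k; ring.
  by rewrite -y2E -h1 -h2 !subrr.
have a00 : a0 = 0.
  transitivity (x1 * (x1 - 1) * (x1 - l) - y1 ^+ 2 - a1 * x1).
    by rewrite /a0 /a1 /x3 /k; ring.
  by rewrite a10 -h1 mul0r !subrr.
transitivity (('X - x1%:P) * ('X - x2%:P) * ('X - x3%:P) + (a1%:P * 'X + a0%:P)).
  by rewrite /a1 /a0 /x3 /legendre_poly /k; ring.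
by rewrite a10 a00 mul0r !addr0.
Qed.

(** The chord and tangent cases have in common that the point added lies on
    the line of slope m and that the line is tangent if the abscissae agree. *)
Lemma legendre_add_line x1 y1 x2 y2 :
    on (Affine x1 y1) -> on (Affine x2 y2) -> ~~ ((x1 == x2) && (y1 == - y2)) ->
  exists m, let x3 := m ^+ 2 + 1 + l - x1 - x2 in
    [/\ add (Affine x1 y1) (Affine x2 y2) = Affine x3 (m * (x1 - x3) - y1),
        y2 = y1 + m * (x2 - x1) &
        x1 = x2 -> m * (y1 *+ 2) = x1 ^+ 2 *+ 3 - (1 + l) * x1 *+ 2 + l].
Proof.
move=> h1 h2 nopp; rewrite /legendre_add (negPf nopp).
set m := if _ then _ else _; exists m; split=> //; rewrite /m; last first.
  move=> e; rewrite e eqxx divfK // -mulr_natr mulf_neq0 //.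
  move: nopp; rewrite e eqxx /=; apply: contra => /eqP y0.
  by move: h2; rewrite /= -e -h1 y0 expr0n /= => /eqP; rewrite sqrf_eq0 => /eqP ->; rewrite oppr0.
have [e|ne] := eqVneq x1 x2; last by rewrite divfK ?subr_eq0 1?eq_sym // addrC subrK.
rewrite e subrr mulr0 addr0; move: nopp; rewrite e eqxx /= -addr_eq0 => nopp.
apply/eqP; rewrite -subr_eq0; apply/eqP; apply: (mulIf nopp).
rewrite mul0r; transitivity (y2 ^+ 2 - y1 ^+ 2); first by ring.
by move: h1 h2 => /= -> ->; rewrite e subrr.
Qed.

Lemma on_legendre_add P Q : on P -> on Q -> on (add P Q).
Proof.
case: P Q => [|x1 y1] [|x2 y2] //; move=> h1 h2.
have [opp|nopp] := boolP ((x1 == x2) && (y1 == - y2)).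
  by rewrite /legendre_add opp.
have [m [-> y2E tg]] := legendre_add_line h1 h2 nopp.
have := line_cubic h1 h2 y2E tg; set x3 := _ - x1 - x2.
move=> /(congr1 (fun p => p.[x3])).
rewrite hornerD hornerN horner_exp horner_legendre_poly !hornerE subrr mulr0.
by move/eqP; rewrite subr_eq0 /= => /eqP ->; ring.
Qed.

(** This statement covers the degenerate cases of the addition law uniformly; the
    group axioms follow from it by cancellation alone. *)
Lemma add_principal P Q : on P -> on Q ->
  prin (finite_part P ++ finite_part Q ++ finite_part (legendre_opp (add P Q))).
Proof.
have prin_opp x y : on (Affine x y) -> prin [:: (x, y); (x, - y)].
  move=> /on_curveE h; apply: (principal_opp_pair two_neq0 legendre_poly_smooth h).
case: P Q => [|x1 y1] [|x2 y2] h1 h2; try exact: prin_opp.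
  exists (1 : coord_ring legendre_poly), 1; split=> //; first exact: oner_neq0.
  by rewrite /divisor_poly big_nil /coord_norm /= expr1n expr0n /=; ring.
have [opp|nopp] := boolP ((x1 == x2) && (y1 == - y2)).
  rewrite /legendre_add opp; case/andP: opp => /eqP -> /eqP -> /=.
  by apply: principal_perm (prin_opp _ _ h2); apply/permP => p /=; ring.
have [m [-> y2E tg]] := legendre_add_line h1 h2 nopp.
have := line_principal two_neq0 legendre_poly_smooth (line_cubic h1 h2 y2E tg).
set x3 := _ - x1 - x2; rewrite !hornerE /=.
have -> : m * x1 + y1 - m * x1 = y1 by ring.
have -> : m * x2 + y1 - m * x1 = y2 by rewrite y2E; ring.
by have -> : m * x3 + y1 - m * x1 = - (m * (x1 - x3) - y1) by ring.
Qed.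

Lemma principal_finite_part_cancel P s : on P ->
  prin (finite_part P ++ finite_part (legendre_opp P) ++ s) -> prin s.
Proof. by case: P => [|x y] //= /on_curveE h; apply: principal_cancel h. Qed.

(** The injectivity of the map from points to ideal classes. *)
Lemma principal_legendre_opp P Q : on P -> on Q ->
  prin (finite_part P ++ finite_part Q) -> Q = legendre_opp P.
Proof.
have size_c := size_legendre_poly; case: P Q => [|x1 y1] [|x2 y2] //.
- by move=> _ _ /(principal1 size_c).
- by move=> _ _ /(principal1 size_c).
move=> /on_curveE h1 /on_curveE h2 /(principal2 size_c two_neq0 h1 h2) [-> ->] //.
Qed.

Lemma map_opp_finite_part P : map (@opp_pt F) (finite_part P) = finite_part (legendre_opp P).
Proof. by case: P. Qed.

(** Concatenating the four relations attached to the four additions, two of them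
    negated, and cancelling opposite points leaves one side and the opposite of
    the other. *)
Lemma legendre_addA P Q S : on P -> on Q -> on S ->
  add P (add Q S) = add (add P Q) S.
Proof.
move=> hP hQ hS.
have hPQ := on_legendre_add hP hQ; have hQS := on_legendre_add hQ hS.
have hl := on_legendre_add hP hQS; have hr := on_legendre_add hPQ hS.
rewrite -[RHS]legendre_oppK; apply: principal_legendre_opp => //.
  exact: on_legendre_opp.
have h1 := principal_cat (add_principal hP hQ) (add_principal hPQ hS).
have h2 := principal_cat (add_principal hQ hS) (add_principal hP hQS).
have := principal_cat h1 (principal_opp h2).
rewrite !map_cat !map_opp_finite_part !legendre_oppK => h.
apply: (principal_finite_part_cancel hP); apply: (principal_finite_part_cancel hQ).
apply: (principal_finite_part_cancel hS).
apply: (principal_finite_part_cancel hPQ); apply: (principal_finite_part_cancel hQS).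
apply: principal_perm h; apply/permP => p; rewrite !count_cat; ring.
Qed.

Lemma legendre_addPN P : add P (legendre_opp P) = Infty.
Proof. by case: P => //= x y; rewrite opprK !eqxx. Qed.

Lemma legendre_addP0 P : add P Infty = P.
Proof. by case: P. Qed.

Lemma legendre_mulS P n : legendre_mul l n.+1 P = add P (legendre_mul l n P).
Proof. by []. Qed.

Section Multiples.
Variable P : legendre_point F.
Hypothesis hP : on P.
Local Notation mul n := (legendre_mul l n P).

Lemma on_legendre_mul n : on (mul n).
Proof. by elim: n => //= n IH; apply: on_legendre_add. Qed.

Lemma legendre_mulD m n : mul (m + n) = add (mul m) (mul n).
Proof.
elim: m => // m IH.
by rewrite addSn !legendre_mulS IH legendre_addA //; exact: on_legendre_mul.
Qed.

Lemma legendre_mulB m n : (n <= m)%N ->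
  add (mul m) (legendre_opp (mul n)) = mul (m - n).
Proof.
move=> nm; have h := on_legendre_mul; have h' := on_legendre_opp (h n).
by rewrite -{1}(subnK nm) legendre_mulD -legendre_addA // legendre_addPN legendre_addP0.
Qed.
End Multiples.

Lemma legendre_mulM P m n : on P ->
  legendre_mul l m (legendre_mul l n P) = legendre_mul l (m * n) P.
Proof. by move=> hP; elim: m => // m IH; rewrite legendre_mulS IH mulSn legendre_mulD. Qed.

Lemma torsion_mul P n : torsion_point l P -> torsion_point l (legendre_mul l n P).
Proof.
move=> [hP [k [k0 kP]]]; split; first exact: on_legendre_mul.
exists k; split=> //; rewrite legendre_mulM // mulnC -legendre_mulM // kP.
by elim: n => // n; rewrite legendre_mulS => ->.
Qed.

End GroupLaw.

(** * Doubling and its 2-adic expansion *)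

(** If the abscissa of P is the fraction f / g, the new pair is a fraction for the
    abscissa of 2P.  Avoiding division lets l be an indeterminate. *)
Definition double_fraction (A : comNzRingType) (l : A) (fg : A * A) : A * A :=
  ((fg.1 ^+ 2 - l * fg.2 ^+ 2) ^+ 2,
   fg.1 * fg.2 * (fg.1 - fg.2) * (fg.1 - l * fg.2) *+ 4).

Definition doubled (A : comNzRingType) (l a : A) (n : nat) : A * A :=
  iter n (double_fraction l) (a, 1).

Lemma doubledS (A : comNzRingType) (l a : A) n :
  doubled l a n.+1 = double_fraction l (doubled l a n).
Proof. by []. Qed.

Lemma rmorph_doubled (A B : comNzRingType) (phi : {rmorphism A -> B}) (l a : A) n :
  doubled (phi l) (phi a) n = (phi (doubled l a n).1, phi (doubled l a n).2).
Proof.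
elim: n => [|n IH]; first by rewrite /doubled /= rmorph1.
by rewrite !doubledS IH; congr pair => /=; ring.
Qed.

(** The first factor vanishes if some 2^k P with k < n has order 1 or 2, the
    second one if the abscissae of 2^m P and 2^n P agree. *)
Definition collision (A : comNzRingType) (l a : A) (m n : nat) : A :=
  (doubled l a n).2 *
  ((doubled l a m).1 * (doubled l a n).2 - (doubled l a n).1 * (doubled l a m).2).

Lemma rmorph_collision (A B : comNzRingType) (phi : {rmorphism A -> B}) (l a : A) m n :
  collision (phi l) (phi a) m n = phi (collision l a m n).
Proof. by rewrite /collision !rmorph_doubled /=; ring. Qed.

Section Doubling.
Variables (F : fieldType) (l : F).
Hypotheses (two_neq0 : 2%:R != 0 :> F) (l_neq0 : l != 0) (l_neq1 : l != 1).

Lemma legendre_double x y : on_legendre l (Affine x y) -> y != 0 ->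
  exists x' y', legendre_add l (Affine x y) (Affine x y) = Affine x' y' /\
    x' * (y ^+ 2 *+ 4) = (x ^+ 2 - l) ^+ 2.
Proof.
move=> h y0.
have nopp : ~~ ((x == x) && (y == - y)).
  by rewrite eqxx /= -addr_eq0 -mulr2n -mulr_natr mulf_neq0.
have [m [-> _ /(_ erefl) mE]] := legendre_add_line two_neq0 h h nopp.
exists (m ^+ 2 + 1 + l - x - x), (m * (x - (m ^+ 2 + 1 + l - x - x)) - y); split=> //.
transitivity ((m * (y *+ 2)) ^+ 2 + (1 + l - x *+ 2) * (y ^+ 2 *+ 4)); first by ring.
by rewrite mE; move: h => /= ->; ring.
Qed.

Lemma legendre_mul_doubled x y n : on_legendre l (Affine x y) ->
  (doubled l x n).2 != 0 ->
  exists y', legendre_mul l (2 ^ n) (Affine x y) =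
    Affine ((doubled l x n).1 / (doubled l x n).2) y'.
Proof.
move=> hP; elim: n => [|n IH]; first by exists y; rewrite /doubled /= divr1.
rewrite doubledS /double_fraction; set f := (doubled _ _ _).1; set g := (doubled _ _ _).2.
rewrite /= => nz.
have g0 : g != 0 by apply: contraNneq nz => ->; rewrite mulr0 !mul0r mul0rn.
have [y' Q] := IH g0; rewrite -/f -/g in Q.
have hQ : on_legendre l (Affine (f / g) y').
  by rewrite -Q; apply: on_legendre_mul.
have y'2 : y' ^+ 2 *+ 4 = f * g * (f - g) * (f - l * g) *+ 4 / g ^+ 4.
  by rewrite hQ; field.
have y'0 : y' != 0.
  apply: contraNneq nz => y'0; move/eqP: y'2.
  rewrite y'0 expr0n /= mul0rn eq_sym mulf_eq0 invr_eq0 (negPf (expf_neq0 _ g0)) orbF.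
  by [].
have [x' [y'' [QQ x'E]]] := legendre_double hQ y'0.
exists y''; rewrite expnS mul2n -addnn legendre_mulD // Q QQ; congr Affine.
move/eqP: x'E; rewrite y'2 => /eqP x'E.
apply: (mulIf nz); rewrite divfK //.
rewrite mulrA in x'E; move/(canRL (divfK (expf_neq0 4 g0))): x'E => ->.
by field.
Qed.

(** The exponents start at 1 because the expansion under doubling sets in only
    after the first step. *)
Lemma pigeonhole_pow2 k : (0 < k)%N ->
  exists m n, [/\ (0 < m)%N, (m < n)%N & (2 ^ m = 2 ^ n %[mod k])%N].
Proof.
case: k => // k _.
pose f (i : 'I_k.+2) : 'I_k.+1 := inord (2 ^ i.+1 %% k.+1).
have /injectivePn[i [j nij fij]] : ~~ injectiveb f.
  apply/negP => /injectiveP /leq_card; rewrite !card_ord ltnn //.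
have e : (2 ^ i.+1 = 2 ^ j.+1 %[mod k.+1])%N.
  by move: fij => /(congr1 (@nat_of_ord _)); rewrite /f !inordK ?ltn_pmod.
case: (ltngtP i j) => [ij|ij|/val_inj eij].
- by exists i.+1, j.+1.
- by exists j.+1, i.+1.
- by rewrite eij eqxx in nij.
Qed.

Lemma torsion_collision x y : torsion_point l (Affine x y) ->
  exists m n, [/\ (0 < m)%N, (m < n)%N & collision l x m n = 0].
Proof.
move=> [hP [k [k0 kP]]]; have [m [n [m0 mn e]]] := pigeonhole_pow2 k0.
exists m, n; split=> //; rewrite /collision.
have [->|nz] := eqVneq (doubled l x n).2 0; first by rewrite mul0r.
have nz' : (doubled l x m).2 != 0.
  apply: contraNneq nz => z; apply/eqP; rewrite -(subnK (ltnW mn)).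
  elim: (n - m)%N => // i IH; rewrite addSn doubledS /double_fraction /=.
  by rewrite IH mulr0 !mul0r mul0rn.
have le2 : (2 ^ m <= 2 ^ n)%N by rewrite leq_exp2l // ltnW.
have E : legendre_mul l (2 ^ n) (Affine x y) = legendre_mul l (2 ^ m) (Affine x y).
  have dv : (k %| 2 ^ n - 2 ^ m)%N by rewrite -eqn_mod_dvd // e.
  have mul0 i : legendre_mul l i Infty = Infty by elim: i.
  by rewrite -{1}(subnK le2) legendre_mulD // -(divnK dv) -legendre_mulM // kP mul0.
have [y1 E1] := legendre_mul_doubled hP nz; have [y2 E2] := legendre_mul_doubled hP nz'.
move: E; rewrite E1 E2 => -[/eqP + _]; rewrite eqr_div // => /eqP ->.
by rewrite subrr mulr0.
Qed.

End Doubling.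

Section Growth.
Variables (R : realType) (F : fieldType) (w : absolute_value R F) (l : F).
Hypotheses (two_neq0 : 2%:R != 0 :> F) (w2 : w 2%:R < 1).

Lemma absv_gt0 x : x != 0 -> 0 < w x.
Proof.
move=> x0; rewrite lt_neqAle absv_ge0 andbT eq_sym.
by apply: contraNneq x0 => /absv_eq0 ->.
Qed.

Lemma absvX x n : w (x ^+ n) = w x ^+ n.
Proof. by elim: n => [|n IH]; rewrite ?absv1 // !exprS absvM IH. Qed.

Lemma absvD_lt x y : w y < w x -> w (x + y) = w x.
Proof.
move=> yx; apply/eqP; rewrite eq_le; apply/andP; split.
  by apply: le_trans (absvD _ _ _) _; rewrite ge_max lexx ltW.
have := absvD w (x + y) (- y); rewrite addrK absvN le_max => /orP[//|].
by rewrite leNgt yx.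
Qed.

Lemma absvB_lt x y : w y < w x -> w (x - y) = w x.
Proof. by move=> h; apply: absvD_lt; rewrite absvN. Qed.

Lemma absvB_le1 x y : w x <= 1 -> w y <= 1 -> w (x - y) <= 1.
Proof. by move=> hx hy; apply: le_trans (absvD _ _ _) _; rewrite absvN ge_max hx. Qed.

Lemma absv4_lt1 : w 4%:R < 1.
Proof.
by rewrite (natrM _ 2 2) absvM mulr_ilt1 ?absv_ge0.
Qed.

Lemma four_neq0 : 4%:R != 0 :> F.
Proof. by rewrite (natrM _ 2 2) mulf_neq0. Qed.

(** The abscissa fg.1 / fg.2 is close enough to infinity, compared with l, for
    doubling to bring it closer. *)
Definition expanding (fg : F * F) : Prop :=
  [/\ fg.2 != 0, w fg.2 < w fg.1 & w (l * fg.2) < w fg.1].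

(** The dominating terms are f^4 in the numerator and 4 f^3 g in the denominator. *)
Lemma expanding_step fg : expanding fg ->
  expanding (double_fraction l fg) /\
  w (fg.1 * (double_fraction l fg).2) < w ((double_fraction l fg).1 * fg.2).
Proof.
case: fg => f g [/= g0 gf lgf].
have f_gt0 : 0 < w f by apply: le_lt_trans gf; exact: absv_ge0.
have g_gt0 : 0 < w g by exact: absv_gt0.
have ff : w ((f ^+ 2 - l * g ^+ 2) ^+ 2) = w f ^+ 4.
  rewrite absvX absvB_lt ?absvX -?exprM //.
  by rewrite expr2 mulrA absvM expr2 ltr_pM ?absv_ge0.
have gg : w (f * g * (f - g) * (f - l * g) *+ 4) = w 4%:R * w f ^+ 3 * w g.
  rewrite -mulr_natr !absvM !absvB_lt //; ring.
have w4 := absv4_lt1; have w40 : 0 < w 4%:R := absv_gt0 four_neq0.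
have f3 : 0 < w f ^+ 3 by rewrite exprn_gt0.
have small z : w z < w f -> w 4%:R * w f ^+ 3 * w z < w f ^+ 4.
  move=> zf; apply: (@le_lt_trans _ _ (w f ^+ 3 * w z)).
    by rewrite -mulrA ler_piMl ?mulr_ge0 ?absv_ge0 // ltW.
  by rewrite [ltRHS]exprSr ltr_pM2l.
rewrite /expanding /double_fraction /=; split; [split|].
- apply/eqP => /(absv_eq0 w)/eqP; rewrite gg.
  by rewrite gt_eqF // !mulr_gt0.
- by rewrite ff gg; exact: small.
- rewrite ff absvM gg.
  have -> : w l * (w 4%:R * w f ^+ 3 * w g) = w 4%:R * w f ^+ 3 * w (l * g).
    by rewrite absvM; ring.
  exact: small.
- rewrite (absvM w f) (absvM w _ g) ff gg.
  have -> : w f * (w 4%:R * w f ^+ 3 * w g) = w 4%:R * (w f ^+ 4 * w g) by ring.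
  by rewrite gtr_pMl ?mulr_gt0 ?exprn_gt0.
Qed.

Lemma expanding_collision a m n : expanding (doubled l a m) -> (m < n)%N ->
  collision l a m n != 0.
Proof.
move=> hm; move=> mn.
suff [[hn _ _] lt_mn] : expanding (doubled l a n) /\
    w ((doubled l a m).1 * (doubled l a n).2) < w ((doubled l a n).1 * (doubled l a m).2).
  rewrite /collision mulf_neq0 // subr_eq0; apply: contraTneq lt_mn => ->.
  by rewrite ltxx.
elim: n mn => // n IH; rewrite ltnS leq_eqVlt => /orP[/eqP <-|mn].
  by rewrite doubledS; have [] := expanding_step hm.
have [en lt_mn] := IH mn; have [en' lt_n] := expanding_step en.
rewrite doubledS; split=> //.
have [gn0 _ _] := en; have [gm0 _ _] := hm.
move: lt_mn lt_n (absv_gt0 gn0) (absv_gt0 gm0).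
case: (double_fraction _ _) => fn' gn'; case: (doubled l a n) => fn gn.
case: (doubled l a m) => fm gm /=; rewrite !absvM => h1 h2 gn_gt0 gm_gt0.
rewrite -(@ltr_pM2l _ (w gn)) //.
apply: (@le_lt_trans _ _ (w gn' * (w fn * w gm))).
  have -> : w gn * (w fm * w gn') = w gn' * (w fm * w gn) by ring.
  by rewrite ler_wpM2l ?absv_ge0 // ltW.
have -> : w gn' * (w fn * w gm) = w fn * w gn' * w gm by ring.
have -> : w gn * (w fn' * w gm) = w fn' * w gn * w gm by ring.
by rewrite ltr_pM2r.
Qed.

(** The complement of the two situations in which a torsion point of abscissa a
    is possible. *)
Definition separated (a : F) : Prop :=
  [\/ 1 < w a /\ w l <= 1,
      [/\ w a <= 1, w l <= 1 & 1 <= w (a ^+ 2 - l)]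
    | w a <= 1 /\ 1 < w l].

Lemma separated_expanding a : a != 0 -> a != 1 -> a != l -> separated a ->
  expanding (doubled l a 1).
Proof.
move=> a0 a1 al; have w4 := absv4_lt1; have w1 : w 1 <= 1 by rewrite absv1.
have D1 : doubled l a 1 = ((a ^+ 2 - l) ^+ 2, 4%:R * (a * (a - 1) * (a - l))).
  by rewrite /doubled /= /double_fraction /=; congr pair; ring.
have g0 : 4%:R * (a * (a - 1) * (a - l)) != 0.
  by rewrite !mulf_neq0 ?subr_eq0 ?four_neq0.
rewrite D1; case=> [[wa wl]|[wa wl wd]|[wa wl]].
- rewrite -D1; apply: (proj1 (expanding_step _)); split=> /=; first exact: oner_neq0.
    by rewrite absv1.
  by rewrite mulr1; exact: le_lt_trans wa.
- have wa1 : w (a * (a - 1) * (a - l)) <= 1.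
    by rewrite !absvM !mulr_ile1 ?mulr_ge0 ?absv_ge0 ?absvB_le1.
  have g1 : w (4%:R * (a * (a - 1) * (a - l))) < 1.
    by apply: le_lt_trans w4; rewrite absvM ler_piMr ?absv_ge0.
  have f1 : 1 <= w ((a ^+ 2 - l) ^+ 2) by rewrite absvX exprn_ege1.
  split=> //=; first exact: lt_le_trans f1.
  apply: lt_le_trans f1; apply: le_lt_trans g1.
  by rewrite absvM ler_piMl ?absv_ge0.
have l_gt0 : 0 < w l by apply: lt_trans wl.
have al_l : w (a - l) = w l by rewrite -absvN opprB absvB_lt //; exact: le_lt_trans wl.
have f1 : w ((a ^+ 2 - l) ^+ 2) = w l ^+ 2.
  rewrite absvX -absvN opprB absvB_lt // absvX; apply: le_lt_trans wl.
  by rewrite exprn_ile1 ?absv_ge0.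
have g1 : w (4%:R * (a * (a - 1) * (a - l))) < w l.
  rewrite !absvM al_l mulrA gtr_pMl //; apply: le_lt_trans w4.
  by rewrite ler_piMr ?absv_ge0 // mulr_ile1 ?absv_ge0 // absvB_le1.
split=> //=; rewrite f1.
  by apply: (lt_trans g1); rewrite expr2 ltr_pMr.
by rewrite absvM expr2 ltr_pM2l.
Qed.

Lemma separated_collision a m n : a != 0 -> a != 1 -> a != l -> separated a ->
  (0 < m)%N -> (m < n)%N -> collision l a m n != 0.
Proof.
move=> a0 a1 al sep m0 mn; apply: expanding_collision mn.
case: m m0 => // m _; elim: m => [|m IH]; first exact: separated_expanding.
by rewrite doubledS; exact: (proj1 (expanding_step IH)).
Qed.

Lemma torsion_not_separated a y : l != 0 -> l != 1 -> a != 0 -> a != 1 -> a != l ->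
  torsion_point l (Affine a y) -> ~ separated a.
Proof.
move=> l0 l1 a0 a1 al tors sep.
have [m [n [m0 mn /eqP]]] := torsion_collision two_neq0 l0 l1 tors.
exact/negP/separated_collision.
Qed.

Lemma torsion_congruence a y : l != 0 -> l != 1 -> a != 0 -> a != 1 -> a != l ->
    torsion_point l (Affine a y) ->
  [/\ w a <= 1, w l <= 1 & w (a ^+ 2 - l) < 1] \/ (1 < w a /\ 1 < w l).
Proof.
move=> l0 l1 a0 a1 al tors.
have := torsion_not_separated l0 l1 a0 a1 al tors.
have [wa|wa] := leP (w a) 1; have [wl|wl] := leP (w l) 1; last 3 first.
- by move=> [] ; apply: Or33.
- by move=> [] ; apply: Or31.
- by right.
have [wd|wd] := ltP (w (a ^+ 2 - l)) 1; first by left.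
by move=> []; apply: Or32.
Qed.

End Growth.

(** * Subrings of finite rank and divisibility by powers of 2 *)

Section FiniteRank.
Variable F : numFieldType.

(** Dependence over the rationals, normalized so that it stays nontrivial
    modulo 2. *)
Definition rank_le (d : nat) (S : F -> Prop) : Prop :=
  forall r (s : 'I_r -> F), (d < r)%N -> (forall i, S (s i)) ->
  exists c : 'I_r -> int,
    (exists i, ~~ (2 %| c i)%Z) /\ \sum_i (c i)%:~R * s i = 0.

Definition is_subring (S : F -> Prop) : Prop :=
  [/\ S 1, forall x y, S x -> S y -> S (x - y) & forall x y, S x -> S y -> S (x * y)].

Section Subring.
Variables (S : F -> Prop) (S_subring : is_subring S).

Lemma subring0 : S 0.
Proof. by case: S_subring => S1 SB _; rewrite -(subrr 1); exact: SB. Qed.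

Lemma subringN x : S x -> S (- x).
Proof.
by have [_ SB _] := S_subring; move=> hx; rewrite -sub0r; apply: SB => //; exact: subring0.
Qed.

Lemma subringB x y : S x -> S y -> S (x - y).
Proof. have [_ SB _] := S_subring; exact: SB. Qed.

Lemma subringD x y : S x -> S y -> S (x + y).
Proof. by move=> hx hy; rewrite -[y]opprK; apply/subringB => //; exact: subringN. Qed.

Lemma subringM x y : S x -> S y -> S (x * y).
Proof. have [_ _ SM] := S_subring; exact: SM. Qed.

Lemma subring_nat n : S n%:R.
Proof.
elim: n => [|n IH]; first exact: subring0.
by rewrite -natr1; apply: subringD => //; case: S_subring.
Qed.

Lemma subring_int n : S n%:~R.
Proof.
case: n => n; first exact: subring_nat.
by rewrite NegzE rmorphN; apply: subringN; exact: subring_nat.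
Qed.

Lemma subringX x n : S x -> S (x ^+ n).
Proof.
move=> hx; elim: n => [|n IH]; first by case: S_subring.
by rewrite exprS; exact: subringM.
Qed.

Lemma subring_sum (I : Type) (r : seq I) (P : pred I) (f : I -> F) :
  (forall i, P i -> S (f i)) -> S (\sum_(i <- r | P i) f i).
Proof. by apply: big_ind; [exact: subring0 | exact: subringD]. Qed.

Variables (d : nat) (S_rank : rank_le d S).

(** The constant coefficient of an integral polynomial annihilating z, once powers
    of X have been removed from it. *)
Lemma divides_int z : S z -> z != 0 ->
  exists k t, [/\ k != 0 :> int, S t & k%:~R = z * t].
Proof.
move=> hz z0.
have [c [[i ci] sum0]] := S_rank (ltnSn d) (fun i => subringX i hz).
pose q := \poly_(i < d.+1) (if insub i is Some j then c j else 0) : {poly int}.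
have qE (j : 'I_d.+1) : q`_j = c j by rewrite coef_poly ltn_ord valK.
have q0 : q != 0.
  apply/eqP => /polyP /(_ i); rewrite qE coef0 => ci0.
  by rewrite ci0 dvdz0 in ci.
have qz : (map_poly intr q).[z] = 0.
  rewrite (@horner_coef_wide _ d.+1) ?(leq_trans (size_poly _ _)) ?size_poly //.
    by rewrite -[RHS]sum0; apply: eq_bigr => j _; rewrite coef_map /= qE.
move: (size q) {-2}q (leqnn (size q)) q0 qz => n {q qE}.
elim: n => [|n IH] q; first by rewrite leqn0 size_poly_eq0 => ->.
move=> qn q0 qz; pose q' := q %/ 'X.
have [q00|q00] := eqVneq q`_0 0.
  have /factor_theorem[p pE] : root q 0 by rewrite rootE horner_coef0 q00.
  rewrite subr0 in pE.
  have p0 : p != 0 by apply: contraNneq q0 => p0; rewrite pE p0 mul0r.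
  apply: (IH p) => //.
    by move: qn; rewrite pE size_mulX // ltnS.
  move/eqP: qz; rewrite pE rmorphM /= map_polyX hornerM hornerX mulf_eq0 (negPf z0) orbF.
  by move/eqP.
exists q`_0, (- \sum_(j < n) (q`_j.+1)%:~R * z ^+ j); split=> //.
  apply: subringN; apply: subring_sum => j _; apply: subringM; first exact: subring_int.
  exact: subringX.
move: qz; rewrite (@horner_coef_wide _ n.+1); last first.
  by rewrite (leq_trans (size_poly _ _)).
rewrite big_ord_recl coef_map /= expr0 mulr1 => /eqP; rewrite addr_eq0 => /eqP ->.
rewrite mulrN mulr_sumr; congr (- _); apply: eq_bigr => j _.
by rewrite coef_map /= exprS /bump /=; ring.
Qed.

Definition multiple (k : F) (z : F) : Prop := exists2 t, S t & z = k * t.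

Lemma int_parity (n : int) :
  n%:~R = (~~ (2 %| n)%Z)%:R + 2%:R * (n %/ 2)%Z%:~R :> F.
Proof.
have {1}-> : n = (~~ (2 %| n)%Z)%:Z + 2 * (n %/ 2)%Z by lia.
by rewrite rmorphD rmorphM.
Qed.

(** A family that is independent modulo 2S has at most d members, since a relation
    over the integers with an odd coefficient reduces to a nontrivial one.  The
    subset sums of a maximal such family represent all classes. *)
Lemma residues_mod2 : exists2 rs : seq F, (forall r, r \in rs -> S r) &
  forall z, S z -> exists2 r, r \in rs & multiple 2%:R (z - r).
Proof.
pose indep r := exists2 s : 'I_r -> F, (forall i, S (s i)) &
  forall b : 'I_r -> bool, multiple 2%:R (\sum_i (b i)%:R * s i) -> forall i, b i = false.
have indep0 : exists r, `[< indep r >].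
  by exists 0%N; apply/asboolP; exists (fun=> 0) => [|b _] [].
have indep_le r : `[< indep r >] -> (r <= d)%N.
  move=> /asboolP[s hs ind]; rewrite leqNgt; apply/negP => dr.
  have [c [[i ci] sum0]] := S_rank dr hs.
  suff even_sum : multiple 2%:R (\sum_i (~~ (2 %| c i)%Z)%:R * s i).
    by have := ind _ even_sum i; rewrite ci.
  exists (- \sum_i (c i %/ 2)%Z%:~R * s i).
    apply: subringN; apply: subring_sum => j _; apply: subringM => //; exact: subring_int.
  rewrite mulrN mulr_sumr; apply/eqP; rewrite -addr_eq0 -big_split -[X in _ == X]sum0 /=.
  by apply/eqP; apply: eq_bigr => j _; rewrite [in RHS]int_parity; ring.
have [r /asboolP[s hs ind] rmax] := ex_maxnP indep0 indep_le.
exists [seq \sum_i (b i)%:R * s i | b : {ffun 'I_r -> bool}].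
  move=> _ /mapP[b _ ->]; apply: subring_sum => j _; apply: subringM => //; exact: subring_nat.
move=> z hz.
(* By maximality, z together with s is dependent modulo 2. *)
pose s' (i : 'I_r.+1) := if unlift ord0 i is Some j then s j else z.
have hs' i : S (s' i) by rewrite /s'; case: unliftP.
have ndep : ~ forall b : 'I_r.+1 -> bool,
    multiple 2%:R (\sum_i (b i)%:R * s' i) -> forall i, b i = false.
  move=> ind'; have := rmax r.+1; rewrite ltnn => h; apply/Bool.diff_false_true/h.
  by apply/asboolP; exists s'.
have [b [hb [i bi]]] : exists b : 'I_r.+1 -> bool,
    multiple 2%:R (\sum_i (b i)%:R * s' i) /\ exists i, b i = true.
  apply: contrapT => nb; apply: ndep => b hb i; apply/negP => bi.
  by apply: nb; exists b; split=> //; exists i.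
pose b' j := b (lift ord0 j).
have sumE : \sum_i (b i)%:R * s' i = (b ord0)%:R * z + \sum_j (b' j)%:R * s j.
  by rewrite big_ord_recl /s' unlift_none; congr (_ + _); apply: eq_bigr => j _; rewrite liftK.
have b0 : b ord0 = true.
  apply: contraT => /negPf b0; rewrite sumE b0 mul0r add0r in hb.
  have b'0 := ind b' hb; case: (unliftP ord0 i) => [j|] iE; last by rewrite iE b0 in bi.
  by move: (b'0 j); rewrite /b' -iE bi.
exists (\sum_j ([ffun j => b' j] j)%:R * s j); first by apply/mapP; exists [ffun j => b' j] => //; rewrite mem_enum.
have eS : \sum_j ([ffun j => b' j] j)%:R * s j = \sum_j (b' j)%:R * s j.
  by apply: eq_bigr => j _; rewrite ffunE.
rewrite eS; move: hb => [t ht]; rewrite sumE b0 mul1r => zE.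
exists (t - \sum_j (b' j)%:R * s j); last by rewrite mulrBr -zE; ring.
apply: subringB => //; apply: subring_sum => j _; apply: subringM => //; exact: subring_nat.
Qed.

Lemma residues_pow2 N : exists2 rs : seq F, (forall r, r \in rs -> S r) &
  forall z, S z -> exists2 r, r \in rs & multiple (2%:R ^+ N) (z - r).
Proof.
elim: N => [|N [rs hrs hN]].
  exists [:: 0] => [r|z hz]; first by rewrite inE => /eqP ->; exact: subring0.
  by exists 0; rewrite ?mem_head //; exists z => //; rewrite expr0 mul1r subr0.
have [rs1 hrs1 h1] := residues_mod2.
exists [seq r + 2%:R ^+ N * r1 | r <- rs, r1 <- rs1].
  move=> _ /allpairsP[[r r1] [/= hr hr1 ->]]; apply: subringD; first exact: hrs.
  apply: subringM; last exact: hrs1.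
  by apply: subringX; exact: subring_nat.
move=> z /hN[r hr [t /h1[r1 hr1 [t1 ht1 tE]] zE]].
exists (r + 2%:R ^+ N * r1); first by apply/allpairsP; exists (r, r1).
exists t1 => //; rewrite opprD addrA zE -mulrBr tE exprSr; ring.
Qed.

Lemma pigeonhole_pow2_mod (u : nat -> F) N : (forall n, S (u n)) ->
  exists m n, (m < n)%N /\ multiple (2%:R ^+ N) (u n - u m).
Proof.
move=> hu; have [rs _ hrs] := residues_pow2 N.
have /choice[f hf] : forall n, exists i : 'I_(size rs), multiple (2%:R ^+ N) (u n - rs`_i).
  move=> n; have [r hr mr] := hrs _ (hu n).
  by exists (Ordinal (etrans (index_mem r rs) hr)); rewrite /= nth_index.
pose g (i : 'I_(size rs).+1) := f i.
have /injectivePn[i [j nij gij]] : ~~ injectiveb g.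
  by apply/negP => /injectiveP /leq_card; rewrite !card_ord ltnn.
have diff (m n : nat) : f m = f n -> multiple (2%:R ^+ N) (u n - u m).
  move=> fmn; have [t ht tE] := hf m; have [t' ht' tE'] := hf n.
  exists (t' - t); first exact: subringB.
  by rewrite mulrBr -tE -tE' fmn; ring.
case: (ltngtP i j) => [ij|ij|/val_inj eij].
- by exists i, j; split=> //; exact: diff.
- by exists j, i; split=> //; apply: diff; exact: esym.
- by rewrite eij eqxx in nij.
Qed.

(** A nonzero e divides an integer k = 2^j m with m odd.  If e is divisible by
    2^(j+1), then m is divisible by 2 in S, and so is 1. *)
Lemma half_of_infinitely_divisible e : S e -> e != 0 ->
  (forall N, multiple (2%:R ^+ N) e) -> exists2 t, S t & 2%:R * t = 1.
Proof.
move=> he e0 div; have [k [s [k0 hs kE]]] := divides_int he e0.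
have k_gt0 : (0 < `|k|)%N by rewrite absz_gt0.
have [[|m] co kab] := pfactor_coprime (isT : prime 2) k_gt0.
  by rewrite kab mul0n in k_gt0.
have [t ht eE] := div (logn 2 `|k|).+1.
have odd_m : odd m.+1 by rewrite -coprime2n.
have : (m.+1)%:R = 2%:R * (t * s * (-1) ^+ (k < 0)%R) :> F.
  have p2 : 2%:R ^+ logn 2 `|k| != 0 :> F by rewrite expf_neq0 ?pnatr_eq0.
  apply: (mulIf p2); rewrite -natrX -natrM -kab.
  have -> : `|k|%N%:R = (-1) ^+ (k < 0)%R * k%:~R :> F.
    by rewrite -[LHS]/((`|k|%N : int)%:~R) abszE normrEsign rmorphM rmorph_sign.
  by rewrite kE eE natrX exprS; ring.
move=> mE; exists (t * s * (-1) ^+ (k < 0)%R - (m.+1)./2%:R).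
  apply: subringB; last exact: subring_nat.
  apply: subringM; first exact: subringM.
  by apply: subringX; apply: subringN; case: S_subring.
have half_m : m.+1 = (1 + 2 * (m.+1)./2)%N by lia.
by rewrite mulrBr -mE {1}half_m natrD natrM addrK.
Qed.
End Subring.
End FiniteRank.

(** * Points of infinite order make 2 invertible *)

Lemma rank_le_sub (F : numFieldType) d (S T : F -> Prop) :
  (forall z, S z -> T z) -> rank_le d T -> rank_le d S.
Proof. by move=> ST hT r s dr hs; apply: hT => // i; exact: ST. Qed.

(** Seen as the coefficients of a polynomial, the vector is a multiple of a
    primitive integral polynomial. *)
Lemma primitive_multiple r (u : 'I_r -> rat) : (exists i, u i != 0) ->
  exists (a : rat) (c : 'I_r -> int), [/\ a != 0, exists i, ~~ (2 %| c i)%Z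
    & forall i, u i = a * (c i)%:~R].
Proof.
move=> [i ui]; pose p := \poly_(k < r) (if insub k is Some j then u j else 0).
have pE (j : 'I_r) : p`_j = u j by rewrite coef_poly ltn_ord valK.
have [q [a a0 pq]] := rat_poly_scale p.
have q0 : q != 0.
  apply: contraNneq ui => q0; rewrite -pE pq q0 coefZ coef_map /= coef0.
  by rewrite mulr0.
pose g := zprimitive q; pose k := zcontents q.
have gE (j : 'I_r) : u j = a%:~R^-1 * k%:~R * (g`_j)%:~R.
  by rewrite -pE pq coefZ coef_map /= {1}[q]zpolyEprim coefZ rmorphM /= mulrA.
exists (a%:~R^-1 * k%:~R), (fun j => g`_j); split=> //.
  by rewrite mulf_neq0 ?invr_eq0 ?intr_eq0 // zcontents_eq0.
apply: contrapT => even_g.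
have : (2 %| zcontents g)%Z.
  rewrite dvdz_contents; apply/polyOverP => j.
  have [jr|rj] := ltnP j r.
    apply/negPn/negP => odd_j; apply: even_g.
    by exists (Ordinal jr).
  rewrite nth_default ?dvdz0 //.
  have size_pq : size p = size q.
    rewrite pq size_scale ?invr_eq0 ?intr_eq0 // size_map_inj_poly //.
    exact: intr_inj.
  by rewrite size_zprimitive -size_pq (leq_trans (size_poly _ _)).
by rewrite zcontents_primitive q0.
Qed.

Section RationalSpan.
Variables (F : numFieldType) (I : finType) (e : I -> F).

Definition rational_span (z : F) : Prop :=
  exists c : I -> rat, z = \sum_i ratr (c i) * e i.

Lemma rational_spanD x y : rational_span x -> rational_span y -> rational_span (x + y).
Proof.
move=> [c ->] [c' ->]; exists (fun i => c i + c' i).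
by rewrite -big_split; apply: eq_bigr => i _; rewrite rmorphD mulrDl.
Qed.

Lemma rational_spanZ q x : rational_span x -> rational_span (ratr q * x).
Proof.
move=> [c ->]; exists (fun i => q * c i).
by rewrite mulr_sumr; apply: eq_bigr => i _; rewrite rmorphM mulrA.
Qed.

Lemma rational_span0 : rational_span 0.
Proof. by exists (fun=> 0); rewrite big1 // => i _; rewrite rmorph0 mul0r. Qed.

Lemma rational_span_sum (J : Type) (r : seq J) (f : J -> F) :
  (forall j, rational_span (f j)) -> rational_span (\sum_(j <- r) f j).
Proof. by move=> h; apply: big_ind => //; [exact: rational_span0|exact: rational_spanD]. Qed.

Lemma rational_span_gen i : rational_span (e i).
Proof.
exists (fun j => (j == i)%:R); rewrite (bigD1 i) //= eqxx rmorph1 mul1r big1 ?addr0 //.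
by move=> j /negPf ->; rewrite rmorph0 mul0r.
Qed.

Lemma rational_span_mul a : (forall i, rational_span (a * e i)) ->
  forall z, rational_span z -> rational_span (a * z).
Proof.
move=> h z [c ->]; rewrite mulr_sumr; apply: rational_span_sum => i.
by rewrite mulrCA; exact: rational_spanZ.
Qed.

(** More than #|I| combinations of #|I| vectors have a rational relation, which
    can be made primitive. *)
Lemma rank_rational_span : rank_le #|I| rational_span.
Proof.
move=> r s dr /choice[c cE].
pose C : 'M[rat]_(r, #|I|) := \matrix_(k, j) c k (enum_val j).
have : kermx C != 0.
  by rewrite -mxrank_eq0 mxrank_ker subn_eq0 -ltnNge (leq_ltn_trans (rank_leq_col _)).
case/rowV0Pn => u /sub_kermxP uC u0.
have [i ui] : exists i, u 0 i != 0.
  apply: contrapT => h; case/eqP: u0; apply/rowP => i; rewrite mxE.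
  by apply/eqP/negPn/negP => ui; apply: h; exists i.
have [a [n [a0 odd_n uE]]] := primitive_multiple (ex_intro (fun i => u 0 i != 0) i ui).
exists n; split=> //.
have ra0 : ratr a != 0 :> F by rewrite fmorph_eq0.
apply: (mulfI ra0); rewrite mulr0 mulr_sumr.
transitivity (\sum_k \sum_i ratr (u 0 k * c k i) * e i).
  apply: eq_bigr => k _; rewrite cE mulr_sumr mulr_sumr; apply: eq_bigr => j _.
  by rewrite uE !rmorphM /= ratr_int; ring.
rewrite exchange_big big1 //= => j _; rewrite -mulr_suml -rmorph_sum /=.
have : (u *m C) 0 (enum_rank j) = 0 by rewrite uC mxE.
rewrite mxE => h; rewrite [X in ratr X](_ : _ = 0) ?rmorph0 ?mul0r // -[RHS]h.
by apply: eq_bigr => k _; rewrite mxE enum_rankK.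
Qed.
End RationalSpan.

Section TwoGenerated.
Variable F : numFieldType.

Lemma algebraic_pow (a : F) : algebraicOver (@ratr F) a ->
  exists d (q : 'I_d -> rat), a ^+ d = \sum_i ratr (q i) * a ^+ i.
Proof.
move=> [p p0 /eqP pa]; exists (size p).-1, (fun i => - (p`_i / lead_coef p)).
have lp : ratr (lead_coef p) != 0 :> F by rewrite fmorph_eq0 lead_coef_eq0.
apply: (mulfI lp); apply/eqP; rewrite -subr_eq0 mulr_sumr -sumrN; apply/eqP.
rewrite -[RHS]pa (@horner_coef_wide _ (size p)) ?size_map_poly //.
rewrite [in RHS](polySpred p0) big_ord_recr /= coef_map addrC; congr (_ + _).
apply: eq_bigr => i _; rewrite coef_map rmorphN fmorph_div /=; field.
exact: lp.
Qed.

(** The span of the monomials a^i b^j of bounded degrees. *)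
Lemma two_generated_span (a b : F) :
    algebraicOver (@ratr F) a -> algebraicOver (@ratr F) b ->
  exists (I : finType) (e : I -> F), [/\ rational_span e 1,
    forall z, rational_span e z -> rational_span e (a * z)
    & forall z, rational_span e z -> rational_span e (b * z)].
Proof.
move=> /algebraic_pow[m [p aE]] /algebraic_pow[n [q bE]].
have m0 : (0 < m)%N.
  case: m p aE => // p; rewrite big_ord0 expr0 => /eqP; by rewrite oner_eq0.
have n0 : (0 < n)%N.
  case: n q bE => // q; rewrite big_ord0 expr0 => /eqP; by rewrite oner_eq0.
pose e (ij : 'I_m * 'I_n) := a ^+ ij.1 * b ^+ ij.2.
have span_e i j (im : (i < m)%N) (jn : (j < n)%N) : rational_span e (a ^+ i * b ^+ j).
  exact: (rational_span_gen e (Ordinal im, Ordinal jn)).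
exists ('I_m * 'I_n)%type, e; split.
- by have := span_e 0%N 0%N m0 n0; rewrite !expr0 mulr1.
- apply: rational_span_mul => -[i j]; rewrite /e /= mulrA -exprS.
  have [im|] := ltnP i.+1 m; first exact: span_e.
  rewrite leq_eqVlt ltnS leqNgt ltn_ord orbF => /eqP <-; rewrite aE mulr_suml.
  apply: rational_span_sum => k; rewrite -mulrA; apply: rational_spanZ; exact: span_e.
- apply: rational_span_mul => -[i j]; rewrite /e /= mulrCA -exprS.
  have [jn|] := ltnP j.+1 n; first exact: span_e.
  rewrite leq_eqVlt ltnS leqNgt ltn_ord orbF => /eqP <-; rewrite bE mulr_sumr.
  apply: rational_span_sum => k; rewrite mulrCA; apply: rational_spanZ; exact: span_e.
Qed.

(** The field Q(a, b) is realized as the set of multipliers of a finite-dimensional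
    space stable under a and b.  This set is visibly a ring, and inverses are
    rational multiples of its elements. *)
Lemma number_field (a b : F) :
    algebraicOver (@ratr F) a -> algebraicOver (@ratr F) b ->
  exists d (K : F -> Prop), [/\ is_subring K, rank_le d K, K a, K b
    & forall z, K z -> K z^-1].
Proof.
move=> ha hb; have [I [e [V1 Va Vb]]] := two_generated_span ha hb.
pose K z := forall v, rational_span e v -> rational_span e (z * v).
have subK : is_subring K.
  split=> [v|x y hx hy v hv|x y hx hy v hv]; first by rewrite mul1r.
    rewrite mulrBl; apply: rational_spanD; first exact: hx.
    by rewrite -mulN1r -[-1](rmorphN1 (@ratr F)); apply: rational_spanZ; exact: hy.
  by rewrite -mulrA; apply: hx; exact: hy.
have rankK : rank_le #|I| K.
  apply: (rank_le_sub _ (@rank_rational_span _ _ e)) => z /(_ 1 V1).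
  by rewrite mulr1.
exists #|I|, K; split=> // z hz.
have [->|z0] := eqVneq z 0; first by rewrite invr0; exact: subring0.
have [k [t [k0 ht kE]]] := divides_int subK rankK hz z0.
have kF : k%:~R != 0 :> F by rewrite intr_eq0.
have -> : z^-1 = ratr k%:~R^-1 * t.
  rewrite fmorphV /= ratr_int; apply: (mulfI kF); rewrite mulVKf //.
  by rewrite kE mulrC mulKf.
by move=> v hv; rewrite -mulrA; apply: rational_spanZ; exact: ht.
Qed.
End TwoGenerated.

Section NonTorsion.
Variables (F : numFieldType) (l x y : F).
Hypotheses (l_neq0 : l != 0) (l_neq1 : l != 1).
Local Notation P := (Affine x y).
Hypothesis P_on : on_legendre l P.
Hypothesis nontorsion : forall n, (0 < n)%N -> legendre_mul l n P <> Infty.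

Definition abscissa (Q : legendre_point F) : F := if Q is Affine u _ then u else 0.

Local Notation mulP n := (legendre_mul l n P).

Variables (S : F -> Prop) (d : nat).
Hypotheses (S_subring : is_subring S) (S_rank : rank_le d S) (Sl : S l).
Hypothesis S_mul : forall n, (0 < n)%N -> S (abscissa (mulP n)).

Let two_neq0 : 2%:R != 0 :> F. Proof. by rewrite pnatr_eq0. Qed.

Let S_nat n : S n%:R. Proof. exact: subring_nat. Qed.

Local Ltac in_S := repeat (first [assumption | exact: S_nat
  | by have [? _ _] := S_subring
  | apply: (subringD S_subring) | apply: (subringN S_subring)
  | apply: (subringM S_subring) | apply: (subringX S_subring)]).

(** Take A = mP and B = nP with abscissae that agree modulo 2^N.  By the addition
    law for B - A and B + A, the squares (y_B + y_A)^2 and (y_B - y_A)^2 are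
    (x_B - x_A)^2 times elements of S, and y_B^2 - y_A^2 is x_B - x_A times one.
    Hence 2^N divides 4 y_A^2, and so (x_A^2 - l)^2 = 4 y_A^2 x(2A).  The
    polynomials 4 x (x - 1)(x - l) and (x^2 - l)^2 generate an ideal that
    contains 16 l^2 (1 - l)^4. *)
Lemma pow2_divides_bezout_constant N :
  multiple S (2%:R ^+ N) (16%:R * l ^+ 2 * (1 - l) ^+ 4).
Proof.
have [m' [n' [mn [t St tE]]]] :=
  pigeonhole_pow2_mod S_subring S_rank N (fun n => S_mul (ltn0Sn n)).
pose m := m'.+1; pose n := n'.+1; have mn1 : (m < n)%N by [].
have Sm : S (abscissa (mulP m)) by exact: S_mul.
have Sn : S (abscissa (mulP n)) by exact: S_mul.
have Sd : S (abscissa (mulP (n - m))) by apply: S_mul; rewrite subn_gt0.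
have Ss : S (abscissa (mulP (n + m))) by exact: S_mul.
have S2 : S (abscissa (mulP (m + m))) by exact: S_mul.
have nzd : mulP (n - m) <> Infty by apply: nontorsion; rewrite subn_gt0.
have nzs : mulP (n + m) <> Infty by exact: nontorsion.
have nz2 : mulP (m + m) <> Infty by exact: nontorsion.
have Om := on_legendre_mul two_neq0 P_on m; have On := on_legendre_mul two_neq0 P_on n.
rewrite -/m -/n in tE.
have := legendre_mulB two_neq0 l_neq0 l_neq1 P_on (ltnW mn1).
have := legendre_mulD two_neq0 l_neq0 l_neq1 P_on n m.
have := legendre_mulD two_neq0 l_neq0 l_neq1 P_on m m.
move: tE Sm Sn Sd Ss S2 nzd nzs nz2 Om On (nontorsion (ltn0Sn m')) (nontorsion (ltn0Sn n')).
rewrite -/m -/n; move: (mulP m) (mulP n) (mulP (n - m)) (mulP (n + m)) (mulP (m + m)).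
move=> [|xm ym] // [|xn yn] // [|xd yd] // [|xs ys] // [|x2 y2] // tE Sm Sn Sd Ss S2.
move=> _ _ _ Om On _ _ /esym E2 /esym Es Ed.
rewrite /= in tE Sm Sn Sd Ss S2.
have ym0 : ym != 0.
  by apply: contraPneq E2 => ->; rewrite /legendre_add oppr0 !eqxx.
have [x2' [y2' [E2' dbl]]] := legendre_double two_neq0 Om ym0.
rewrite E2 in E2'; case: E2' dbl => <- _ dbl.
have xmn : xn != xm.
  apply/eqP => exy; have : (yn - ym) * (yn + ym) = 0.
    by rewrite -subr_sqr; move: Om On => /= -> ->; rewrite exy subrr.
  move/eqP; rewrite mulf_eq0 subr_eq0 addr_eq0 => /orP[] /eqP ey.
    by move: Ed; rewrite /legendre_add /= exy ey opprK !eqxx.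
  by move: Es; rewrite /legendre_add /= exy ey !eqxx.
have xmn' : xm - xn != 0 by rewrite subr_eq0 eq_sym.
have Hs : (yn - ym) ^+ 2 = (xn - xm) ^+ 2 * (xs + xn + xm - 1 - l).
  by move: Es; rewrite /legendre_add (negPf xmn) /= => -[<- _]; field.
have Hd : (yn + ym) ^+ 2 = (xn - xm) ^+ 2 * (xd + xn + xm - 1 - l).
  by move: Ed; rewrite /legendre_add /= (negPf xmn) /= => -[<- _]; field.
have Hy : yn ^+ 2 - ym ^+ 2 = (xn - xm) *
    (xn ^+ 2 + xn * xm + xm ^+ 2 - (1 + l) * (xn + xm) + l).
  by move: Om On => /= -> ->; ring.
have [u Su uE] : multiple S (2%:R ^+ N) (ym ^+ 2 *+ 4).
  exists (t * ((xn - xm) * (xs + xn + xm - 1 - l) + (xn - xm) * (xd + xn + xm - 1 - l)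
      - 2%:R * (xn ^+ 2 + xn * xm + xm ^+ 2 - (1 + l) * (xn + xm) + l))).
    by in_S.
  rewrite mulrA -tE.
  transitivity ((yn - ym) ^+ 2 + (yn + ym) ^+ 2 - 2%:R * (yn ^+ 2 - ym ^+ 2)); first by ring.
  by rewrite Hs Hd Hy; ring.
have cE : ym ^+ 2 *+ 4 = xm * (xm - 1) * (xm - l) *+ 4 by move: Om => /= ->.
(* X^2 - l and X(X - 1)(X - l) are coprime: a combination of them is -l (1 - l)^2. *)
pose k1 := xm *+ 2 + 1 + l; pose c := xm * (xm - 1) * (xm - l).
pose g := xm ^+ 2 - l; pose k2 := - (xm - 1 - l) * k1 - 4%:R * l.
have bezout : - (l * (1 - l) ^+ 2) = c * k1 + g * k2.
  by rewrite /c /g /k2 /k1; ring.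
exists (u * (4%:R * k1 * (c * k1 + 2%:R * g * k2)  + 16%:R * x2 * k2 ^+ 2)).
  by rewrite /k2 /k1 /g /c; in_S.
transitivity (16%:R * (c * k1 + g * k2) ^+ 2); first by rewrite -bezout; ring.
transitivity ((ym ^+ 2 *+ 4) * (4%:R * k1 * (c * k1 + 2%:R * g * k2)) +
    16%:R * (x2 * (ym ^+ 2 *+ 4)) * k2 ^+ 2); last by rewrite uE; ring.
by rewrite dbl cE /c /g; ring.
Qed.

(** A nonzero element of S cannot be divisible by all powers of 2 unless 2 is
    a unit. *)
Lemma nontorsion_half : exists2 t, S t & 2%:R * t = 1.
Proof.
apply: (@half_of_infinitely_divisible F S S_subring d S_rank
    (16%:R * l ^+ 2 * (1 - l) ^+ 4)).
- by in_S.
- by rewrite !mulf_neq0 ?expf_neq0 ?pnatr_eq0 // subr_eq0 eq_sym.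
exact: pow2_divides_bezout_constant.
Qed.

End NonTorsion.

(** * Enumerating the ring generated by the multiples of a point *)

Section Machine.
Variables (F : fieldType) (l a : F).

Let C := a * (a - 1) * (a - l).

(** Multiples of P = (a, y) have the form (X, Y y) with X and Y rational functions
    of l and a, so no square root is needed to compute them.  The pair Q stands
    for such a multiple.  When Q.1 = a the tangent at P is used: this is right
    for Q = P, and for Q = -P the sequence restarts at 2P, so that it never
    leaves the multiples of P. *)
Definition next_multiple (Q : F * F) : F * F :=
  let m := if Q.1 == a then (a ^+ 2 *+ 3 - (1 + l) * a *+ 2 + l) / (C *+ 2)
           else (Q.2 - 1) / (Q.1 - a) in
  let x := m ^+ 2 * C + 1 + l - a - Q.1 in
  (x, m * (a - x) - 1).

Definition multiple_coords (n : nat) : F * F := iter n next_multiple (a, 1).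

(** The current multiple of P, a monomial under construction, and the sum of the
    monomials completed so far. *)
Definition word_state := ((F * F) * (F * F))%type.

Definition start : word_state := ((a, 1), (1, 0)).

(** Letter 0 is the one that never needs to come last: the words are the base 5
    expansions of integers, read from the least significant digit, and a final
    0 would be lost. *)
Definition do_letter (d : nat) (st : word_state) : word_state :=
  let: (Q, (p, t)) := st in
  match d with
  | 0 => (next_multiple Q, (p, t))
  | 1 => (Q, (1, t + p))
  | 2 => (Q, (- p, t))
  | 3 => (Q, (p * l, t))
  | _ => ((a, 1), (p * Q.1, t))
  end.

Fixpoint run_word_rec (fuel N : nat) (st : word_state) : word_state :=
  if fuel is k.+1 then
    if N is 0 then st else run_word_rec k (N %/ 5) (do_letter (N %% 5) st)
  else st.
(** The fuel N suffices because N / 5 < N for N > 0. *)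
Definition run_word N := run_word_rec N N.

Lemma run_word_rec_fuel k N st : (N <= k)%N -> run_word_rec k N st = run_word N st.
Proof.
rewrite /run_word; move: {2 5}N (leqnn N) => k'.
elim: k k' N st => [|k IH] [|k'] [|N] st //; rewrite ?ltnS => h1 h2 /=.
by apply: IH; lia.
Qed.

Lemma run_wordS N st : (0 < N)%N ->
  run_word N st = run_word (N %/ 5) (do_letter (N %% 5) st).
Proof. by case: N => // N _; rewrite {1}/run_word /= run_word_rec_fuel //; lia. Qed.

Inductive monomial : F -> Prop :=
| Monomial1 : monomial 1
| MonomialParam m : monomial m -> monomial (l * m)
| MonomialCoord n m : monomial m -> monomial ((multiple_coords n).1 * m).

Inductive generated : F -> Prop :=
| Generated0 : generated 0
| GeneratedD u m : generated u -> monomial m -> generated (u + m)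
| GeneratedB u m : generated u -> monomial m -> generated (u - m).

Lemma monomialM m m' : monomial m -> monomial m' -> monomial (m * m').
Proof.
move=> hm hm'; elim: hm => [|u _ IH|n u _ IH]; first by rewrite mul1r.
  by rewrite -mulrA; exact: MonomialParam.
by rewrite -mulrA; exact: MonomialCoord.
Qed.

Lemma generated_monomial m : monomial m -> generated m.
Proof. by move=> hm; rewrite -[m]add0r; apply: GeneratedD => //; exact: Generated0. Qed.

Lemma generatedDB u v : generated u -> generated v -> generated (u + v) /\ generated (u - v).
Proof.
move=> hu; elim=> [|v' m _ [IH1 IH2] hm|v' m _ [IH1 IH2] hm].
- by rewrite subr0 addr0.
- by rewrite addrA opprD addrA; split; [exact: GeneratedD|exact: GeneratedB].
- rewrite addrA; have -> : u - (v' - m) = u - v' + m by ring.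
  by split; [exact: GeneratedB|exact: GeneratedD].
Qed.

Lemma generatedM u v : generated u -> generated v -> generated (u * v).
Proof.
have mulm m : monomial m -> forall u, generated u -> generated (u * m).
  move=> hm u'; elim=> [|u1 m1 _ IH hm1|u1 m1 _ IH hm1]; first by rewrite mul0r; exact: Generated0.
    by rewrite mulrDl; apply: GeneratedD => //; exact: monomialM.
  by rewrite mulrBl; apply: GeneratedB => //; exact: monomialM.
move=> hu; elim=> [|v' m _ IH hm|v' m _ IH hm]; first by rewrite mulr0; exact: Generated0.
  by rewrite mulrDr; apply: (generatedDB IH (mulm _ hm _ hu)).1.
by rewrite mulrBr; apply: (generatedDB IH (mulm _ hm _ hu)).2.
Qed.

Section Reach.
Variable h : F.

Definition reaches (st : word_state) : Prop :=
  exists2 N, (0 < N)%N & (run_word N st).2.2 = h.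

(** Prepending the letter d to the word of N > 0 gives the word of 5 N + d. *)
Lemma reaches_letter d st : (d < 5)%N -> reaches (do_letter d st) -> reaches st.
Proof.
move=> d5 [N N0 hN]; exists (N * 5 + d)%N; first by rewrite ltn_addr // muln_gt0 N0.
rewrite run_wordS ?ltn_addr ?muln_gt0 ?N0 //.
by rewrite divnMDl // divn_small // addn0 modnMDl modn_small.
Qed.

Lemma reaches_multiple n p t : reaches (multiple_coords n, (p, t)) -> reaches ((a, 1), (p, t)).
Proof.
elim: n => // n IH hn; apply: IH; exact: (@reaches_letter 0).
Qed.

Lemma reaches_monomial m : monomial m -> forall p t,
  reaches ((a, 1), (p * m, t)) -> reaches ((a, 1), (p, t)).
Proof.
elim=> [|u _ IH|n u _ IH] p t; first by rewrite mulr1.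
  by rewrite mulrA => /IH hn; exact: (@reaches_letter 3).
rewrite mulrA => /IH hn; apply: (@reaches_multiple n).
exact: (@reaches_letter 4).
Qed.

(** Phrased for an arbitrary starting sum t, so that the summands of u can be
    appended one after the other. *)
Lemma reaches_generated u : generated u -> forall t,
  (t + u = h \/ reaches ((a, 1), (1, t + u))) ->
  (t = h \/ reaches ((a, 1), (1, t))).
Proof.
have finish m t : t + m = h \/ reaches ((a, 1), (1, t + m)) -> reaches ((a, 1), (m, t)).
  by case=> [tm|hm]; [exists 1%N|exact: (@reaches_letter 1)].
elim=> [|u1 m _ IH hm|u1 m _ IH hm] t; first by rewrite addr0.
  rewrite addrA => /finish hf; apply: IH; right.
  by apply: (reaches_monomial hm); rewrite mul1r.
rewrite addrA => /finish hf; apply: IH; right.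
by apply: (reaches_monomial hm); rewrite mul1r; exact: (@reaches_letter 2).
Qed.
End Reach.

Lemma word_of_generated h : generated h -> h != 0 ->
  exists2 N, (0 < N)%N & (run_word N start).2.2 = h.
Proof.
move=> hh h0; have [] := reaches_generated (h := h) hh (t := 0).
- by left; rewrite add0r.
- by move=> e; rewrite -e eqxx in h0.
- by [].
Qed.

Section Correct.
Hypotheses (two_neq0 : 2%:R != 0 :> F) (l_neq0 : l != 0) (l_neq1 : l != 1).
Variable y : F.
Hypotheses (P_on : on_legendre l (Affine a y)) (y_neq0 : y != 0).
Local Notation mulP n := (legendre_mul l n (Affine a y)).

Let CE : C = y ^+ 2. Proof. by rewrite P_on. Qed.

Lemma next_multipleE n Q : (0 < n)%N -> mulP n = Affine Q.1 (Q.2 * y) ->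
  mulP (if Q.1 == a then 2 else n.+1) =
    Affine (next_multiple Q).1 ((next_multiple Q).2 * y).
Proof.
case: Q => X Y n0 /= hn; rewrite /next_multiple CE /=.
case: eqVneq => [Xa|Xa].
  have y2 : y != - y by rewrite -addr_eq0 -mulr2n -mulr_natr mulf_neq0.
  rewrite !legendre_mulS /= !eqxx (negPf y2) /=.
  by rewrite Xa; congr Affine; field; rewrite y_neq0 ?two_neq0.
rewrite legendre_mulS hn /legendre_add eq_sym (negPf Xa) /=.
by congr Affine; field; rewrite subr_eq0.
Qed.

Lemma next_multiple_is_multiple n Q : (0 < n)%N -> mulP n = Affine Q.1 (Q.2 * y) ->
  exists n', (1 < n')%N /\
    mulP n' = Affine (next_multiple Q).1 ((next_multiple Q).2 * y).
Proof.
move=> n0 hn; exists (if Q.1 == a then 2 else n.+1); split; last exact: next_multipleE hn.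
by case: ifP.
Qed.

Lemma multiple_coords_is_multiple n : (0 < n)%N ->
  exists n', (1 < n')%N /\
    mulP n' = Affine (multiple_coords n).1 ((multiple_coords n).2 * y).
Proof.
case: n => // n _; elim: n => [|n [n' [n'1 IH]]].
  by apply: (@next_multiple_is_multiple 1) => //=; rewrite mul1r.
exact: next_multiple_is_multiple (ltnW n'1) IH.
Qed.

Lemma collinear_return n : (1 < n)%N -> forall Y, mulP n = Affine a Y ->
  torsion_point l (Affine a y).
Proof.
move=> n1 Y hn; split=> //.
have : Y = y \/ Y = - y.
  have : (Y - y) * (Y + y) = 0.
    have := on_legendre_mul two_neq0 P_on n; rewrite hn /= => hY.
    by rewrite -subr_sqr hY -P_on subrr.
  move/eqP; rewrite mulf_eq0 subr_eq0 addr_eq0 => /orP[]/eqP; [by left|by right].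
case=> e; rewrite e in hn.
  exists (n - 1)%N; rewrite subn_gt0; split=> //.
  rewrite -legendre_mulB ?(ltnW n1) // hn.
  by rewrite /legendre_mul /= opprK !eqxx.
by exists n.+1; split=> //; rewrite legendre_mulS hn /= opprK !eqxx.
Qed.

(** A multiple nP with n > 1 has the abscissa of P only if it is P or -P. *)
Lemma multiple_coords_return n : (0 < n)%N -> (multiple_coords n).1 = a ->
  torsion_point l (Affine a y).
Proof.
move=> /multiple_coords_is_multiple[n' [n'1 hn]] e; rewrite e in hn.
exact: collinear_return hn.
Qed.

Lemma multiple_coordsE n : (forall k, (0 < k)%N -> (multiple_coords k).1 <> a) ->
  mulP n.+1 = Affine (multiple_coords n).1 ((multiple_coords n).2 * y).
Proof.
move=> h; elim: n => [|n IH]; first by rewrite /= mul1r.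
have := next_multipleE (ltn0Sn n) IH; case: n IH => [|n] IH; first by rewrite eqxx.
by case: eqP => // /h; move=> /(_ isT).
Qed.

Lemma torsion_return : torsion_point l (Affine a y) ->
  exists2 n, (0 < n)%N & (multiple_coords n).1 = a.
Proof.
move=> [_ [[|k] [k0 hk]]] //; apply: contrapT => nret.
have h n : (0 < n)%N -> (multiple_coords n).1 <> a by move=> n0 e; apply: nret; exists n.
by have := multiple_coordsE k h; rewrite hk.
Qed.

Section Integrality.
Variables (R : realType) (w : absolute_value R F).
Hypotheses (wl : w l <= 1) (w_mul : forall n X Y, mulP n = Affine X Y -> w X <= 1).

(** The ring generated by l and the abscissae of the multiples of P lies in the
    valuation ring. *)
Lemma run_word_integral N : w (run_word N start).2.2 <= 1.
Proof.
have wa : w a <= 1 by apply: (w_mul (n := 1)).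
suff inv st : (exists n, (0 < n)%N /\ mulP n = Affine st.1.1 (st.1.2 * y)) ->
    w st.2.1 <= 1 -> w st.2.2 <= 1 -> w (run_word N st).2.2 <= 1.
  apply: inv => /=; last by rewrite absv0 ler01.
    by exists 1%N; split=> //=; rewrite mul1r.
  by rewrite absv1.
(* The letter 4 resets the current multiple to P itself. *)
have start_mul : exists n, (0 < n)%N /\ mulP n = Affine a (1 * y).
  by exists 1%N; split=> //=; rewrite mul1r.
have [k] := ubnP N; elim: k N st => // k IH N [Q [p t]] Nk /= hQ wp wt.
have [->//|N0] := posnP N; rewrite run_wordS //; have := ltn_pmod N (isT : (0 < 5)%N).
have wM u v : w u <= 1 -> w v <= 1 -> w (u * v) <= 1.
  by move=> hu hv; rewrite absvM mulr_ile1 ?absv_ge0.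
have wQ : w Q.1 <= 1 by have [n [_ /w_mul]] := hQ.
have Nk' : (N %/ 5 < k)%N by lia.
case: (N %% 5)%N => [|[|[|[|[|//]]]]] _; apply: IH => //=.
- have [n [n0 hn]] := hQ; have [n' [n'1 hn']] := next_multiple_is_multiple n0 hn.
  by exists n'; split=> //; exact: ltnW.
- by rewrite absv1.
- by apply: le_trans (absvD _ _ _) _; rewrite ge_max wt.
- by rewrite absvN.
- exact: wM.
- exact: wM.
Qed.
End Integrality.
End Correct.
End Machine.

(** * The search for a certificate terminates *)

Section MapPoint.
Variables (F E : fieldType) (phi : {rmorphism F -> E}).

Definition map_point (P : legendre_point F) : legendre_point E :=
  if P is Affine x y then Affine (phi x) (phi y) else Infty.

Lemma map_legendre_add l P Q :
  legendre_add (phi l) (map_point P) (map_point Q) = map_point (legendre_add l P Q).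
Proof.
case: P Q => [|x1 y1] [|x2 y2] //=.
rewrite -rmorphN !(inj_eq (fmorph_inj phi)); case: ifP => // _ /=.
by case: ifP => _; congr Affine;
  rewrite !(fmorphV, rmorphMn, rmorphN, rmorphD, rmorphXn, rmorphM, rmorph1).
Qed.

Lemma map_legendre_mul l n P :
  legendre_mul (phi l) n (map_point P) = map_point (legendre_mul l n P).
Proof.
elim: n => // n IH; rewrite (legendre_mulS (phi l)) (legendre_mulS l) IH.
exact: map_legendre_add.
Qed.

Lemma map_on_legendre l P : on_legendre (phi l) (map_point P) <-> on_legendre l P.
Proof.
case: P => //= x y; have -> : phi x * (phi x - 1) * (phi x - phi l) =
  phi (x * (x - 1) * (x - l)) by rewrite !rmorphM !rmorphB rmorph1.
by rewrite -rmorphXn; split => [/fmorph_inj|->].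
Qed.

Lemma map_torsion_point l P : torsion_point (phi l) (map_point P) <-> torsion_point l P.
Proof.
split=> -[/map_on_legendre hP [n [n0 hn]]]; split=> //; exists n; split=> //.
  by move: hn; rewrite map_legendre_mul; case: (legendre_mul _ _ _).
by rewrite map_legendre_mul hn.
Qed.
End MapPoint.

Local Ltac in_K := repeat (first [assumption | match goal with
  | KMn : forall u n, _ -> ?K (u *+ n) |- ?K (_ *+ _) => apply KMn
  | KX : forall u n, _ -> ?K (u ^+ n) |- ?K (_ ^+ _) => apply KX
  | KB : forall u v, _ -> _ -> ?K (u - v) |- ?K (_ - _) => apply KB
  | KD : forall u v, _ -> _ -> ?K (u + v) |- ?K (_ + _) => apply KD
  | KM : forall u v, _ -> _ -> ?K (u * v) |- ?K (_ * _) => apply KM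
  end]).

(** Either P is torsion, and then a multiple of P returns to the abscissa a, or the
    ring generated by l and the abscissae contains 1/2, which some word outputs.
    The abscissae lie in the field generated by l and a, which gives the finite
    rank. *)
Lemma search_succeeds (F : fieldType) (E : numFieldType) (phi : {rmorphism F -> E})
    (l a y : F) :
  algebraicOver (@ratr E) (phi l) -> algebraicOver (@ratr E) (phi a) ->
  l != 0 -> l != 1 -> on_legendre l (Affine a y) -> y != 0 ->
  exists2 K, (0 < K)%N &
    (multiple_coords l a K).1 = a \/ 2%:R * (run_word l a K (start a)).2.2 = 1.
Proof.
move=> alg_l alg_a l0 l1 hP y0.
have two_E : 2%:R != 0 :> E by rewrite pnatr_eq0.
have two_F : 2%:R != 0 :> F by rewrite -(fmorph_eq0 phi) rmorph_nat.
have [tors|ntors] := pselect (torsion_point l (Affine a y)).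
  by have [K K0 hK] := torsion_return two_F hP y0 tors; exists K => //; left.
have noret n : (0 < n)%N -> (multiple_coords l a n).1 <> a.
  by move=> n0 /(multiple_coords_return two_F l0 l1 hP y0 n0).
have mulE n := multiple_coordsE two_F hP y0 n noret.
have [d [K [subK rankK Kl Ka Kinv]]] := number_field alg_l alg_a.
have KnatE n : K n%:R by exact: subring_nat.
have KD u v : K u -> K v -> K (u + v) by exact: subringD.
have KB u v : K u -> K v -> K (u - v) by exact: subringB.
have KM u v : K u -> K v -> K (u * v) by exact: subringM.
have K1 : K 1 by case: subK.
have KX u n : K u -> K (u ^+ n) by exact: subringX.
have KMn u n : K u -> K (u *+ n) by move=> hu; rewrite -mulr_natr; exact: KM.
have KQ n : K (phi (multiple_coords l a n).1) /\ K (phi (multiple_coords l a n).2).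
  elim: n => [|n [IH1 IH2]]; first by rewrite /= rmorph1.
  rewrite /multiple_coords iterS -/(multiple_coords l a n) /next_multiple.
  set m := if _ then _ else _.
  have Km : K (phi m).
    rewrite /m; case: ifP => _; rewrite fmorph_div; apply: (KM _ _ _ (Kinv _ _)).
    - by rewrite !(rmorphMn, rmorphN, rmorphD, rmorphXn, rmorphM, rmorph1) /=; in_K.
    - by rewrite !(rmorphMn, rmorphN, rmorphD, rmorphXn, rmorphM, rmorph1) /=; in_K.
    - by rewrite rmorphB rmorph1; in_K.
    - by rewrite rmorphB; in_K.
  have Kx : K (phi (m ^+ 2 * (a * (a - 1) * (a - l)) + 1 + l - a - (multiple_coords l a n).1)).
    by rewrite !(rmorphN, rmorphD, rmorphXn, rmorphM, rmorph1) /=; in_K.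
  by split=> //=; rewrite !(rmorphN, rmorphD, rmorphXn, rmorphM, rmorph1); in_K.
pose S z := exists2 u, generated l a u & z = phi u.
have subS : is_subring S.
  split=> [|_ _ [u hu ->] [v hv ->]|_ _ [u hu ->] [v hv ->]].
  - by exists 1; rewrite ?rmorph1 //; apply: generated_monomial; exact: Monomial1.
  - by exists (u - v); rewrite ?rmorphB //; exact: (generatedDB hu hv).2.
  - by exists (u * v); rewrite ?rmorphM //; exact: generatedM.
have rankS : rank_le d S.
  apply: rank_le_sub rankK => _ [u hu ->].
  have Kmono m : monomial l a m -> K (phi m).
    elim=> [|v _ IH|n v _ IH]; rewrite ?rmorph1 ?rmorphM; auto.
    by apply: KM => //; exact: (KQ n).1.
  elim: hu => [|v m _ IH /Kmono hm|v m _ IH /Kmono hm].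
  - by rewrite rmorph0; exact: (KnatE 0%N).
  - by rewrite rmorphD; auto.
  - by rewrite rmorphB; auto.
have := @nontorsion_half E (phi l) (phi a) (phi y) _ _ _ _ S d subS rankS.
rewrite !fmorph_eq0 !fmorph_eq1 => /(_ l0 l1).
have hP' : on_legendre (phi l) (Affine (phi a) (phi y)) by exact/(map_on_legendre phi l (Affine a y)).
move=> /(_ hP'); case.
- move=> n n0; rewrite -[Affine _ _]/(map_point phi (Affine a y)) map_legendre_mul => hn.
  apply: ntors; split=> //; exists n; split=> //.
  by move: hn; case: (legendre_mul _ _ _).
- exists l => //; have := generated_monomial (MonomialParam (Monomial1 l a)).
  by rewrite mulr1.
- move=> [|n] // _; exists (multiple_coords l a n).1; last first.
    rewrite -[Affine _ _]/(map_point phi (Affine a y)) map_legendre_mul.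
    by rewrite mulE.
  have := generated_monomial (MonomialCoord n (Monomial1 l a)).
  by rewrite mulr1.
move=> _ [h hh ->]; rewrite -(rmorph_nat phi) -rmorphM -(rmorph1 phi) => /fmorph_inj h2.
have h0 : h != 0 by apply: contraPneq h2 => ->; rewrite mulr0 => /esym/eqP; rewrite oner_eq0.
have [N N0 hN] := word_of_generated hh h0.
by exists N => //; right; rewrite hN.
Qed.

(** * The program *)

(** The registers that a command may change; all others are preserved, which
    keeps the specifications below local. *)
Fixpoint written (c : cmd) : seq nat :=
  match c with
  | Skip => [::]
  | Assign k _ => [:: k]
  | Seq c1 c2 => written c1 ++ written c2
  | IfZero _ c1 c2 => written c1 ++ written c2
  | WhileNonzero _ c1 => written c1
  end.

Section Logic.
Variable F : fieldType.
Implicit Types (s : nat -> F) (e : expr) (c : cmd) (Q : (nat -> F) -> Prop).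

Definition halts c s Q : Prop := exists2 s', exec c s s' & Q s'.

Lemma halts_conseq c s Q Q' : (forall s', Q s' -> Q' s') -> halts c s Q -> halts c s Q'.
Proof. by move=> QQ' [s' hc /QQ' hs']; exists s'. Qed.

Lemma halts_skip s Q : Q s -> halts Skip s Q.
Proof. by exists s => //; exact: ExecSkip. Qed.

Lemma halts_assign s k e Q : Q (upd s k (eval s e)) -> halts (Assign k e) s Q.
Proof. by exists (upd s k (eval s e)) => //; exact: ExecAssign. Qed.

Lemma halts_seq c1 c2 s Q : halts c1 s (fun s' => halts c2 s' Q) -> halts (Seq c1 c2) s Q.
Proof. by move=> [s1 h1 [s2 h2 hQ]]; exists s2 => //; exact: ExecSeq h1 h2. Qed.

Lemma halts_if e c1 c2 s Q : (if eval s e == 0 then halts c1 s Q else halts c2 s Q) ->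
  halts (IfZero e c1 c2) s Q.
Proof.
case: eqP => he [s' hs' hQ]; exists s' => //; first exact: ExecIfTrue.
exact: ExecIfFalse.
Qed.

Lemma halts_while_stop e c s Q : eval s e = 0 -> Q s -> halts (WhileNonzero e c) s Q.
Proof. by move=> he hQ; exists s => //; exact: ExecWhileStop. Qed.

Lemma halts_while_step e c s Q : eval s e != 0 ->
  halts c s (fun s' => halts (WhileNonzero e c) s' Q) -> halts (WhileNonzero e c) s Q.
Proof.
move=> /eqP he [s1 h1 [s2 h2 hQ]]; exists s2 => //; exact: ExecWhileStep h1 h2.
Qed.

Lemma exec_frame c s s' k : exec c s s' -> k \notin written c -> s' k = s k.
Proof.
elim=> //= {c s s'} [s k' e|s1 s2 s3 c1 c2 _ IH1 _ IH2|s s' e c1 c2 _ _ IH|s s' e c1 c2 _ _ IH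
  |s1 s2 s3 e c _ _ IH1 _ IH2].
- by rewrite inE /upd => /negPf ->.
- by rewrite mem_cat => /norP[k1 k2]; rewrite IH2 // IH1.
- by rewrite mem_cat => /norP[k1 k2]; exact: IH.
- by rewrite mem_cat => /norP[k1 k2]; exact: IH.
- by move=> kc; rewrite IH2 // IH1.
Qed.

Lemma halts_frame c s Q : halts c s Q ->
  halts c s (fun s' => Q s' /\ forall k, k \notin written c -> s' k = s k).
Proof. by move=> [s' hc hQ]; exists s' => //; split=> // k; exact: exec_frame hc. Qed.
End Logic.

Definition Sub e1 e2 := Add e1 (Opp e2).
Definition Div e1 e2 := Mul e1 (Inv e2).

(** The primitive operations offer no constant 0, hence 1 - 1. *)
Definition Nat n : expr := iter n (Add One) (Add One (Opp One)).

Lemma eval_Nat (F : fieldType) (s : nat -> F) n : eval s (Nat n) = n%:R.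
Proof.
elim: n => [|n IH]; first by rewrite /= subrr.
by rewrite [LHS]/= -/(Nat n) IH mulrS.
Qed.

Section Program.

(** Registers 3, 4 and 5 hold l, a and a (a - 1)(a - l).  Registers 6 and 7 hold the
    multiple of P tested for a return, 8 the number of the current word, 9 the
    part of the word still to be read, 10 and 11 the quotient and remainder of 9
    by 5, 12 to 15 the state of the word machine.  Register 16 is the slope of a
    line, 17 tells the search to go on, 18 receives its outcome (1 for torsion);
    19, 20 and 21 keep the first outcome and the two inputs. *)
Definition rL := Reg 3. Definition rA := Reg 4. Definition rC := Reg 5.

Definition advance (x y : nat) : cmd :=
  Seq (IfZero (Sub (Reg x) rA)
    (Assign 16 (Div
      (Add (Sub (Mul (Nat 3) (Mul rA rA)) (Mul (Nat 2) (Mul (Add One rL) rA))) rL)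
      (Mul (Nat 2) rC)))
    (Assign 16 (Div (Sub (Reg y) One) (Sub (Reg x) rA))))
  (Seq (Assign x (Sub (Sub (Add (Add (Mul (Mul (Reg 16) (Reg 16)) rC) One) rL) rA) (Reg x)))
    (Assign y (Sub (Mul (Reg 16) (Sub rA (Reg x))) One))).

(** The loop stops as soon as register 11 is one of 0, 1, 2, 3 and 4, which a product of
    differences tests. *)
Definition divide5 : cmd :=
  Seq (Assign 10 (Nat 0)) (Seq (Assign 11 (Reg 9))
  (WhileNonzero
    (Mul (Reg 11) (Mul (Sub (Reg 11) (Nat 1)) (Mul (Sub (Reg 11) (Nat 2))
      (Mul (Sub (Reg 11) (Nat 3)) (Sub (Reg 11) (Nat 4))))))
    (Seq (Assign 11 (Sub (Reg 11) (Nat 5))) (Assign 10 (Add (Reg 10) One))))).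

Definition letter : cmd :=
  IfZero (Reg 11) (advance 12 13)
  (IfZero (Sub (Reg 11) (Nat 1)) (Seq (Assign 15 (Add (Reg 15) (Reg 14))) (Assign 14 One))
  (IfZero (Sub (Reg 11) (Nat 2)) (Assign 14 (Opp (Reg 14)))
  (IfZero (Sub (Reg 11) (Nat 3)) (Assign 14 (Mul (Reg 14) rL))
    (Seq (Assign 14 (Mul (Reg 14) (Reg 12))) (Seq (Assign 12 rA) (Assign 13 One)))))).

Definition word : cmd :=
  WhileNonzero (Reg 9) (Seq divide5 (Seq letter (Assign 9 (Reg 10)))).

Definition search_body : cmd :=
  Seq (advance 6 7)
  (IfZero (Sub (Reg 6) rA) (Seq (Assign 18 One) (Assign 17 (Nat 0)))
  (Seq (Assign 8 (Add (Reg 8) One)) (Seq (Assign 9 (Reg 8))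
  (Seq (Assign 12 rA) (Seq (Assign 13 One) (Seq (Assign 14 One) (Seq (Assign 15 (Nat 0))
  (Seq word
    (IfZero (Sub (Mul (Nat 2) (Reg 15)) One)
      (Seq (Assign 18 (Nat 0)) (Assign 17 (Nat 0))) Skip))))))))).

Definition decide : cmd :=
  Seq (Assign 5 (Mul (Mul rA (Sub rA One)) (Sub rA rL)))
  (Seq (Assign 6 rA) (Seq (Assign 7 One) (Seq (Assign 8 (Nat 0)) (Seq (Assign 17 One)
  (WhileNonzero (Reg 17) search_body))))).

(** The parameter a always belongs to the first set of torsion parameters, so it is
    common to both if and only if b is a torsion abscissa on the curve with
    parameter a; and symmetrically for b. *)
Definition torsion_program : cmd :=
  Seq (Assign 20 (Reg 0)) (Seq (Assign 21 (Reg 1))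
  (Seq (Assign 3 (Reg 20)) (Seq (Assign 4 (Reg 21)) (Seq decide
  (Seq (Assign 19 (Reg 18))
  (Seq (Assign 3 (Reg 21)) (Seq (Assign 4 (Reg 20)) (Seq decide
  (Seq (Assign 0 (Add (Reg 19) (Reg 18)))
    (IfZero (Reg 19) (Assign 1 (Reg 21))
      (Seq (Assign 1 (Reg 20)) (Assign 2 (Reg 21))))))))))))).

Variable F : fieldType.
Hypothesis char0 : forall n, (n%:R == 0 :> F) = (n == 0)%N.

Lemma natr_eq m n : (m%:R == n%:R :> F) = (m == n)%N.
Proof.
wlog le_mn : m n / (m <= n)%N.
  by move=> h; case: (leqP m n) => [/h//|/ltnW/h]; rewrite eq_sym => ->; rewrite eq_sym.
by rewrite eq_sym -subr_eq0 -natrB // char0 subn_eq0 eqn_leq le_mn.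
Qed.

Variables l a : F.
Let C := a * (a - 1) * (a - l).

Definition ready (s : nat -> F) := [/\ s 3 = l, s 4 = a & s 5 = C].

Lemma halts_advance x y s : ready s -> (x \notin [:: 3; 4; 5; 16]%N) ->
    (y \notin [:: 3; 4; 5; 16]%N) -> x != y ->
  halts (advance x y) s (fun s' => (s' x, s' y) = next_multiple l a (s x, s y)).
Proof.
rewrite !inE => -[s3 s4 s5] /norP[x3 /norP[x4 /norP[x5 x16]]] /norP[y3 /norP[y4 /norP[y5 y16]]] xy.
apply: halts_seq; apply: halts_if.
(* The two branches differ only in the slope left in register 16. *)
have tail m s1 : s1 16 = m -> (forall k, k != 16 -> s1 k = s k) ->
    m = (if s x == a then (a ^+ 2 *+ 3 - (1 + l) * a *+ 2 + l) / (C *+ 2)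
         else (s y - 1) / (s x - a)) ->
  halts (Seq (Assign x (Sub (Sub (Add (Add (Mul (Mul (Reg 16) (Reg 16)) rC) One) rL) rA) (Reg x)))
    (Assign y (Sub (Mul (Reg 16) (Sub rA (Reg x))) One))) s1
    (fun s' => (s' x, s' y) = next_multiple l a (s x, s y)).
  move=> m16 frame mE; apply: halts_seq; apply: halts_assign; apply: halts_assign.
  rewrite /= /upd !eqxx (negPf xy).
  rewrite ![_ == x]eq_sym (negPf x4) (negPf x16).
  rewrite m16 !frame // s3 s4 s5 /next_multiple /= -mE.
  by congr pair; rewrite expr2.
rewrite /= s4 subr_eq0; case: eqVneq => sx; apply: halts_assign; apply: tail.
- by rewrite /upd eqxx.
- by move=> k /negPf k16; rewrite /upd k16.
- by rewrite sx eqxx /= s3 s4 s5; congr (_ / _); ring.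
- by rewrite /upd eqxx.
- by move=> k /negPf k16; rewrite /upd k16.
- by rewrite (negPf sx) /= s4.
Qed.

Lemma halts_divide5 (s : nat -> F) N : s 9 = N%:R ->
  halts divide5 s (fun s' => s' 10 = (N %/ 5)%:R /\ s' 11 = (N %% 5)%:R).
Proof.
move=> s9; apply: halts_seq; apply: halts_assign; apply: halts_seq; apply: halts_assign.
rewrite /= subrr /upd /=.
suff loop n q (s' : nat -> F) : s' 11 = n%:R -> s' 10 = q%:R ->
    halts (WhileNonzero
    (Mul (Reg 11) (Mul (Sub (Reg 11) (Nat 1)) (Mul (Sub (Reg 11) (Nat 2))
      (Mul (Sub (Reg 11) (Nat 3)) (Sub (Reg 11) (Nat 4))))))
    (Seq (Assign 11 (Sub (Reg 11) (Nat 5))) (Assign 10 (Add (Reg 10) One)))) s'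
    (fun s' => s' 10 = (q + n %/ 5)%:R /\ s' 11 = (n %% 5)%:R).
  by apply: (loop N 0%N).
have [k] := ubnP n; elim: k n q s' => // k IH n q s' nk s11 s10.
have condE : (eval s' (Mul (Reg 11) (Mul (Sub (Reg 11) (Nat 1)) (Mul (Sub (Reg 11) (Nat 2))
      (Mul (Sub (Reg 11) (Nat 3)) (Sub (Reg 11) (Nat 4)))))) == 0) = (n < 5)%N.
  rewrite [eval _ _]/= -[1 + (1 - 1)]/(eval s' (Nat 1)).
  rewrite -[1 + (1 + (1 - 1))]/(eval s' (Nat 2)) -[1 + (1 + (1 + (1 - 1)))]/(eval s' (Nat 3)).
  rewrite -[1 + (1 + (1 + (1 + (1 - 1))))]/(eval s' (Nat 4)) !eval_Nat s11.
  rewrite !mulf_eq0 char0 !subr_eq0 !natr_eq; lia.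
have [n5|n5] := ltnP n 5.
  apply: halts_while_stop; first by apply/eqP; rewrite condE.
  by rewrite divn_small // modn_small // addn0.
apply: halts_while_step; first by rewrite condE -leqNgt.
apply: halts_seq; apply: halts_assign; apply: halts_assign.
apply: (halts_conseq _ (IH (n - 5)%N q.+1 _ _ _ _)).
- move=> s2 [-> ->]; split; congr _%:R; lia.
- lia.
- by rewrite /upd [eval _ _]/= -/(Nat 5) [LHS]/= -[X in _ - X]/(eval s' (Nat 5)) eval_Nat s11 natrB.
- by rewrite /upd /= s10 mulrSr.
Qed.

Definition word_regs (s : nat -> F) : word_state F := ((s 12, s 13), (s 14, s 15)).

Lemma halts_letter s d : ready s -> (d < 5)%N -> s 11 = d%:R ->
  halts letter s (fun s' => word_regs s' = do_letter l a d (word_regs s)).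
Proof.
move=> hs d5 s11; have [s3 s4 s5] := hs.
have zero k : (eval s (Sub (Reg 11) (Nat k)) == 0) = (d == k).
  by rewrite [eval _ _]/= -/(Nat k) eval_Nat s11 subr_eq0 natr_eq.
have advance_regs : halts (advance 12 13) s
    (fun s' => word_regs s' = (next_multiple l a (s 12, s 13), (s 14, s 15))).
  have := halts_frame (halts_advance hs (isT : 12%N \notin [:: 3; 4; 5; 16]%N)
    (isT : 13%N \notin [:: 3; 4; 5; 16]%N) isT).
  by apply: halts_conseq => s' [<- fr]; rewrite /word_regs !(fr 14, fr 15).
case: d d5 s11 zero => [|[|[|[|[|//]]]]] _ s11 zero; rewrite /letter.
- by apply: halts_if; rewrite /= s11 eqxx.
- apply: halts_if; rewrite [eval _ _]/= s11 oner_eq0.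
  apply: halts_if; rewrite zero.
  by do ?[apply: halts_seq | apply: halts_assign].
- apply: halts_if; rewrite [eval _ _]/= s11 char0; do 2 (apply: halts_if; rewrite zero).
  exact: halts_assign.
- apply: halts_if; rewrite [eval _ _]/= s11 char0; do 3 (apply: halts_if; rewrite zero).
  by apply: halts_assign; rewrite /word_regs /upd /= s3.
- apply: halts_if; rewrite [eval _ _]/= s11 char0; do 3 (apply: halts_if; rewrite zero).
  by do ?[apply: halts_seq | apply: halts_assign]; rewrite /word_regs /upd /= s4.
Qed.

Lemma halts_word s N : ready s -> s 9 = N%:R ->
  halts word s (fun s' => word_regs s' = run_word l a N (word_regs s)).
Proof.
have [k] := ubnP N; elim: k N s => // k IH N s Nk hs s9.
have [N0|N0] := posnP N.
  by apply: halts_while_stop; rewrite /= ?s9 N0 //.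
apply: halts_while_step; first by rewrite /= s9 char0 -lt0n.
apply: halts_seq; have := halts_frame (halts_divide5 s9).
apply: halts_conseq => s1 [[s1_10 s1_11] fr1].
have [s3 s4 s5] := hs.
have hs1 : ready s1 by rewrite /ready !fr1.
apply: halts_seq; have := halts_frame (halts_letter hs1 (ltn_pmod N (isT : (0 < 5)%N)) s1_11).
apply: halts_conseq => s2 [s2E fr2]; apply: halts_assign.
have [s13 s14 s15] := hs1.
have hs3 : ready (upd s2 9 (eval s2 (Reg 10))) by rewrite /ready /upd /= !fr2.
have Nk' : (N %/ 5 < k)%N by lia.
have s9' : upd s2 9 (eval s2 (Reg 10)) 9 = (N %/ 5)%:R by rewrite /upd /= fr2.
apply: halts_conseq (IH _ _ Nk' hs3 s9').
move=> s' ->; rewrite [RHS]run_wordS //; congr (run_word _ _ _ _).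
by rewrite {1}/word_regs /upd /= -/(word_regs s2) s2E /word_regs !fr1.
Qed.

Let found (n : nat) : Prop :=
  (multiple_coords l a n).1 = a \/ 2%:R * (run_word l a n (start a)).2.2 = 1.

Definition verdict (s : nat -> F) : Prop :=
  (s 18 = 1 /\ exists2 n, (0 < n)%N & (multiple_coords l a n).1 = a) \/
  (s 18 = 0 /\ exists2 n, (0 < n)%N & 2%:R * (run_word l a n (start a)).2.2 = 1).

(** If the loop continues, then the current index carries no certificate; this is
    what bounds the number of iterations by the first index that carries one. *)
Lemma halts_search_body s n : ready s -> (s 6, s 7) = multiple_coords l a n ->
    s 8 = n%:R -> s 17 = 1 ->
  halts search_body s (fun s' =>
    (s' 17 = 0 /\ verdict s') \/
    [/\ ~ found n.+1, s' 17 = 1, s' 8 = n.+1%:R & (s' 6, s' 7) = multiple_coords l a n.+1]).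
Proof.
move=> hs hQ s8 s17; have [s3 s4 s5] := hs; apply: halts_seq.
have := halts_frame (halts_advance hs (isT : 6%N \notin [:: 3; 4; 5; 16]%N)
  (isT : 7%N \notin [:: 3; 4; 5; 16]%N) isT).
apply: halts_conseq => s1 [s1Q' fr1].
have {s1Q'} s1Q : (s1 6, s1 7) = multiple_coords l a n.+1 by rewrite s1Q' hQ.
have hs1 : ready s1 by rewrite /ready !fr1.
have s16 : s1 6 = (multiple_coords l a n.+1).1 by rewrite -s1Q.
apply: halts_if; rewrite [eval _ _]/= (fr1 4 isT) s4 subr_eq0; case: eqP => ret.
  apply: halts_seq; do 2 apply: halts_assign.
  left; rewrite /verdict /upd /= subrr; split=> //; left; split=> //.
  by exists n.+1; rewrite -?s16.
do 6 (apply: halts_seq; apply: halts_assign).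
set s2 := upd _ _ _.
have hs2 : ready s2 by rewrite /ready /s2 /upd /= !fr1.
have s29 : s2 9 = n.+1%:R by rewrite /s2 /upd /= fr1 // s8 -natr1.
have s2W : word_regs s2 = start a.
  by rewrite /word_regs /start /s2 /upd /= subrr fr1 // s4.
apply: halts_seq; have := halts_frame (halts_word hs2 s29).
apply: halts_conseq => s3' [s3W fr3].
apply: halts_if.
have -> : eval s3' (Sub (Mul (Nat 2) (Reg 15)) One) =
    2%:R * (run_word l a n.+1 (start a)).2.2 - 1.
  by rewrite -s2W -s3W -(eval_Nat s3' 2).
rewrite subr_eq0; case: eqP => half.
  apply: halts_seq; do 2 apply: halts_assign.
  left; rewrite /verdict /upd /= subrr; split=> //; right; split=> //.
  by exists n.+1.
apply: halts_skip; right; split.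
- by case=> // e; apply: ret; rewrite s16.
- by rewrite fr3 // /s2 /upd /= fr1.
- by rewrite fr3 // /s2 /upd /= fr1 // s8 -natr1.
- by rewrite !fr3 // -s1Q /s2 /upd.
Qed.

Lemma halts_decide s : s 3 = l -> s 4 = a ->
  (exists2 n, (0 < n)%N & found n) -> halts decide s verdict.
Proof.
move=> s3 s4 [n n0 hn].
do 5 (apply: halts_seq; apply: halts_assign); set s1 := upd _ _ _.
have hs1 : ready s1 by rewrite /ready /s1 /upd /= s3 s4.
have s1_8 : s1 8 = 0%:R by rewrite /s1 /upd /= subrr.
have s1Q : (s1 6, s1 7) = multiple_coords l a 0 by rewrite /s1 /upd /= s4.
have s1_17 : s1 17 = 1 by [].
suff loop k j s' : (n - j < k)%N -> (j < n)%N -> ready s' -> s' 8 = j%:R ->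
    (s' 6, s' 7) = multiple_coords l a j -> s' 17 = 1 ->
    halts (WhileNonzero (Reg 17) search_body) s' verdict.
  by apply: (loop n.+1 0%N) => //; rewrite subn0.
move=> {s s3 s4 s1 hs1 s1_8 s1Q s1_17}.
elim: k j s' => // k IH j s nk jn hs s8 sQ s17.
apply: halts_while_step; first by rewrite /= s17 oner_eq0.
have := halts_frame (halts_search_body hs sQ s8 s17).
apply: halts_conseq => s' [[[s'17 hv]|[nf s'17 s'8 s'Q]] fr].
  exact: halts_while_stop.
have [s3 s4 s5] := hs; apply: (IH j.+1) => //; last by rewrite /ready !fr.
- lia.
- by rewrite ltn_neqAle jn andbT; apply: contra_notN nf => /eqP ->.
Qed.

Definition torsion_abscissa : Prop := exists y, torsion_point l (Affine a y).

Definition decided (s : nat -> F) : Prop :=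
  (torsion_abscissa /\ s 18 = 1) \/ (~ torsion_abscissa /\ s 18 = 0).

(** The hypothesis on words is the soundness of the output 1/2 as a certificate, the
    only point where the 2-adic absolute value matters to the program. *)
Lemma verdict_decided s y : l != 0 -> l != 1 -> on_legendre l (Affine a y) -> y != 0 ->
    (torsion_abscissa -> forall n, 2%:R * (run_word l a n (start a)).2.2 <> 1) ->
  verdict s -> decided s.
Proof.
move=> l0 l1 hP y0 sound; have two_neq0 : 2%:R != 0 :> F by rewrite char0.
case=> [[s18 [n n0 hn]]|[s18 [n n0 hn]]]; [left|right]; split=> //.
  by exists y; exact: multiple_coords_return hn.
by move=> /sound /(_ n).
Qed.

End Program.

Lemma torsion_program_correct (F : fieldType)
    (char0 : forall n, (n%:R == 0 :> F) = (n == 0)%N) (a b : F) :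
  (forall s, s 3 = a -> s 4 = b -> halts decide s (decided a b)) ->
  (forall s, s 3 = b -> s 4 = a -> halts decide s (decided b a)) ->
  computes_set torsion_program a b
    [set x | x = a /\ torsion_abscissa a b \/ x = b /\ torsion_abscissa b a]%classic.
Proof.
move=> dec_ab dec_ba.
suff [s hs [n [sn sE]]] : halts torsion_program (nth 0 [:: a; b]) (fun s => exists n,
    s 0 = n%:R /\ forall x, (x = a /\ torsion_abscissa a b \/ x = b /\ torsion_abscissa b a)
      <-> exists2 k, (k < n)%N & x = s k.+1).
  exists s, n; split=> //; apply/seteqP; split=> x /=; by rewrite sE.
do 4 (apply: halts_seq; apply: halts_assign); apply: halts_seq.
set s1 := upd _ 4 _; have := halts_frame (dec_ab s1 erefl erefl).
apply: halts_conseq => s2 [dec2 fr2].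
do 3 (apply: halts_seq; apply: halts_assign); apply: halts_seq.
set s3 := upd _ 4 _.
have s3_3 : s3 3 = b by rewrite /s3 /upd /= fr2.
have s3_4 : s3 4 = a by rewrite /s3 /upd /= fr2.
have := halts_frame (dec_ba s3 s3_3 s3_4).
apply: halts_conseq => s4 [dec4 fr4].
have s4_19 : s4 19 = s2 18 by rewrite fr4.
have s4_20 : s4 20 = a by rewrite fr4 // /s3 /upd /= fr2.
have s4_21 : s4 21 = b by rewrite fr4 // /s3 /upd /= fr2.
apply: halts_seq; apply: halts_assign; apply: halts_if.
have -> : eval (upd s4 0 (eval s4 (Add (Reg 19) (Reg 18)))) (Reg 19) = s2 18.
  by rewrite /upd /= s4_19.
case: dec2 => -[ta s2_18]; case: dec4 => -[tb s4_18]; rewrite s2_18 ?eqxx ?oner_eq0.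
- apply: halts_seq; do 2 apply: halts_assign; exists 2%N.
  rewrite /upd /= s4_19 s2_18 s4_18 s4_20 s4_21; split=> // x; split.
    by case=> -[-> _]; [exists 0%N|exists 1%N].
  by case=> -[|[|//]] _ ->; [left|right].
- apply: halts_seq; do 2 apply: halts_assign; exists 1%N.
  rewrite /upd /= s4_19 s2_18 s4_18 addr0 s4_20 s4_21; split=> // x; split.
    by case=> -[-> //] _; exists 0%N.
  by case=> -[|//] _ ->; left.
- apply: halts_assign; exists 1%N.
  rewrite /upd /= s4_19 s2_18 s4_18 add0r s4_21; split=> // x; split.
    by case=> -[-> //] _; exists 0%N.
  by case=> -[|//] _ ->; right.
- apply: halts_assign; exists 0%N.
  rewrite /upd /= s4_19 s2_18 s4_18 add0r; split=> // x; split; last by case.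
  by case=> -[].
Qed.

(** * Algebraic numbers, reduction and simultaneous torsion *)
Local Open Scope classical_set_scope.

Section AbsoluteValues.
Variable R : realType.

Lemma is_Qp_absv_p p (K : fieldType) (v : absolute_value R K) :
  prime p -> is_Qp p v -> v p%:R = p%:R^-1.
Proof.
move=> pp [vq _ _]; have := vq p%:R; rewrite ratr_nat => ->.
rewrite /padic_abs pnatr_eq0 eqn0Ngt prime_gt0 //=.
have -> : p%:R = (p : int)%:~R :> rat by [].
by rewrite numq_int denq_int /= logn1 expr0 logn_prime // eqxx expr1 mul1r.
Qed.

Section Pullback.
Variables (F E : fieldType) (w : absolute_value R E) (i : {rmorphism F -> E}).

Definition pullback_absv : absolute_value R F.
Proof.
apply: (@AbsoluteValue R F (fun x => w (i x))) => [x|x|x y|x y].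
- exact: absv_ge0.
- by rewrite absv_eq0; split=> [/eqP|->]; rewrite ?rmorph0 // fmorph_eq0 => /eqP.
- by rewrite rmorphM absvM.
- by rewrite rmorphD absvD.
Defined.
End Pullback.

Lemma reduction_eq (F : fieldType) (w : absolute_value R F) x y :
  w x <= 1 -> w y <= 1 -> w (x - y) < 1 -> reduction w x = reduction w y.
Proof.
move=> hx hy hxy; rewrite /reduction.
rewrite (insubT (fun z => z \in integral w) hx) (insubT (fun z => z \in integral w) hy) /=.
by congr Some; apply/eqP; rewrite -Quotient.idealrBE.
Qed.

Lemma reduction_infinity (F : fieldType) (w : absolute_value R F) x :
  1 < w x -> reduction w x = None.
Proof.
move=> hx; rewrite /reduction insubN //.
by rewrite unfold_in /integral -ltNge.
Qed.
End AbsoluteValues.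

(** A multiple with w x > 1 >= w l would be torsion and expanding. *)
Lemma torsion_multiples_integral (R : realType) (F : fieldType) (w : absolute_value R F)
    (l : F) P n x y :
  2%:R != 0 :> F -> w 2%:R < 1 -> l != 0 -> l != 1 -> w l <= 1 -> torsion_point l P ->
  legendre_mul l n P = Affine x y -> w x <= 1.
Proof.
move=> two w2 l0 l1 wl /(torsion_mul two l0 l1 n) + hn; rewrite hn => tx.
rewrite leNgt; apply/negP => wx.
have x0 : x != 0 by apply: contraTneq wx => ->; rewrite absv0 ltr10.
have x1 : x != 1 by apply: contraTneq wx => ->; rewrite absv1 ltxx.
have xl : x != l by apply: contraTneq wx => ->; rewrite -leNgt.
have := torsion_congruence two w2 l0 l1 x0 x1 xl tx.
case=> [[wx' _ _]|[_ wl']]; first by rewrite ltNge wx' in wx.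
by rewrite ltNge wl in wl'.
Qed.

Section Qbar.
Variable R : realType.
Local Notation Q := (Qbar R).
Local Notation C := R[i].

Definition embed : {rmorphism Q -> C} := \val.

Lemma embed_algebraic (z : Q) : algebraicOver (@ratr C) (embed z).
Proof. by apply/asboolP; case: z. Qed.

Lemma algebraic_embed (z : C) : algebraicOver (@ratr C) z -> exists z' : Q, z = embed z'.
Proof.
move=> hz; have hz' : z \in @algebraic_number R by exact/asboolP.
by exists (MkQbar hz').
Qed.

Lemma root_embed (p : {poly Q}) z : p != 0 -> root (map_poly embed p) z ->
  exists z' : Q, z = embed z'.
Proof.
move=> p0 pz; apply: algebraic_embed; apply/integral_algebraic.
apply: (integral_root _ pz); first by rewrite map_poly_eq0.
move=> _ /(nthP 0)[k _ <-]; rewrite coef_map; apply/integral_algebraic.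
exact: embed_algebraic.
Qed.

Lemma sqrt_embed (z : C) (c : Q) : z ^+ 2 = embed c -> exists z' : Q, z = embed z'.
Proof.
move=> zc; apply: (@root_embed ('X^2 - c%:P)); first exact: monic_neq0 (monicXnsubC _ _).
by rewrite rmorphB rmorphXn /= (map_polyX embed) (map_polyC embed) rootE !hornerE zc subrr.
Qed.

Lemma Qbar_natr_eq0 n : (n%:R == 0 :> Q) = (n == 0)%N.
Proof. by rewrite -(fmorph_eq0 embed) rmorph_nat pnatr_eq0. Qed.

Lemma torsion_abscissa_embed (l a : Q) :
  (exists y, torsion_point (embed l) (Affine (embed a) y)) <-> torsion_abscissa l a.
Proof.
split=> [[y tors]|[y tors]].
  have [y' yE] : exists y' : Q, y = embed y'.
    apply: (@sqrt_embed _ (a * (a - 1) * (a - l))).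
    by case: tors => h _; rewrite h !rmorphM !rmorphB rmorph1.
  by exists y'; apply/(map_torsion_point embed); rewrite yE in tors.
by exists (embed y); apply/(map_torsion_point embed l (Affine a y)).
Qed.

Lemma curve_point (l a : Q) : a != 0 -> a != 1 -> a != l ->
  exists2 y, on_legendre l (Affine a y) & y != 0.
Proof.
move=> a0 a1 al; pose c := a * (a - 1) * (a - l).
have [y yE] : exists y : Q, sqrtc (embed c) = embed y.
  by apply: (@sqrt_embed _ c); rewrite sqr_sqrtc.
have y2 : y ^+ 2 = c by apply: (fmorph_inj embed); rewrite rmorphXn -yE sqr_sqrtc.
by exists y => //; rewrite -sqrf_eq0 y2 !mulf_neq0 ?subr_eq0.
Qed.

Variable w : absolute_value R Q.
Hypothesis w2 : w 2%:R < 1.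

Let two_Q : 2%:R != 0 :> Q. Proof. by rewrite Qbar_natr_eq0. Qed.
Let two_C : 2%:R != 0 :> C. Proof. by rewrite pnatr_eq0. Qed.

(** If w a <= 1, then the residue of a^2 cannot be both 0 and 1. *)
Lemma separated_parameter (a : Q) : a != 0 -> a != 1 ->
  exists2 l, a != l & separated w l a.
Proof.
move=> a0 a1; have [wa|wa] := leP (w a) 1; last first.
  by exists 0 => //; apply: Or31; rewrite absv0 ler01.
have [wa1|wa1] := leP 1 (w (a ^+ 2)).
  by exists 0 => //; apply: Or32; rewrite absv0 ler01 subr0.
exists 1 => //; apply: Or32; rewrite absv1 lexx.
by split=> //; rewrite -absvN opprB absvB_lt ?absv1.
Qed.

(** The collision polynomial in the indeterminate l vanishes at the given parameter
    but not at a separated one. *)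
Lemma torsion_params_algebraic (a : Q) (l : C) : a != 0 -> a != 1 ->
  torsion_params (embed a) l -> exists l' : Q, l = embed l'.
Proof.
move=> a0 a1 [l0 l1 [y tors]].
have [m [n [m0 mn hc]]] := torsion_collision two_C l0 l1 tors.
have [l1' al sep] := separated_parameter a0 a1.
pose p := collision ('X : {poly Q}) a%:P m n.
apply: (@root_embed p).
  have pl : p.[l1'] = collision l1' a m n.
    rewrite -[LHS]/(horner_eval l1' p) -rmorph_collision.
    by congr (collision _ _ m n); [exact: hornerX | exact: hornerC].
  apply: contra_neq (separated_collision two_Q w2 a0 a1 al sep m0 mn) => p0.
  by rewrite -pl p0 horner0.
pose phi := horner_eval l \o map_poly embed : {rmorphism {poly Q} -> C}.
have phiX : phi 'X = l.
  by rewrite -[LHS]/((map_poly embed 'X).[l]) (map_polyX embed) hornerX.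
have phiC : phi a%:P = embed a.
  by rewrite -[LHS]/((map_poly embed a%:P).[l]) (map_polyC embed) hornerC.
by rewrite rootE -[_.[l]]/(phi p) -(rmorph_collision phi) phiX phiC hc.
Qed.

Section TwoAbscissae.
Variables a b : Q.
Hypotheses (a0 : a != 0) (a1 : a != 1) (b0 : b != 0) (b1 : b != 1).
Hypothesis sep_red : forall x y : Q, (x = a /\ y = b) \/ (x = b /\ y = a) ->
  ~ (1 < w x /\ 1 < w y) /\ ~ [/\ w x <= 1, w y <= 1 & w (x - y) < 1].
Local Notation T := (simultaneous_torsion (embed a) (embed b)).

Let ab : a != b.
Proof.
apply/eqP => e; have [h1 h2] := sep_red (or_introl (conj erefl erefl)).
rewrite e in h1 h2; case: (leP (w b) 1) => wb; last by apply: h1.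
by apply: h2; rewrite subrr absv0 ltr01.
Qed.

(** A parameter other than a and b satisfies the congruence of
    [torsion_congruence] with respect to both. *)
Lemma common_parameter (l : Q) : T (embed l) -> l = a \/ l = b.
Proof.
move=> [[l0 l1 /torsion_abscissa_embed[y ta]] [_ _ /torsion_abscissa_embed[y' tb]]].
rewrite fmorph_eq0 in l0; rewrite fmorph_eq1 in l1.
have [->|la] := eqVneq l a; first by left.
have [->|lb] := eqVneq l b; first by right.
have [h1 h2] := sep_red (or_introl (conj erefl erefl)).
rewrite eq_sym in la; rewrite eq_sym in lb.
have := torsion_congruence two_Q w2 l0 l1 a0 a1 la ta.
have := torsion_congruence two_Q w2 l0 l1 b0 b1 lb tb.
case=> [[wb wl wbl]|[wb wl]] [[wa wl' wal]|[wa wl']].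
- case: h2; split=> //.
  have : w ((a - b) ^+ 2) < 1.
    have -> : (a - b) ^+ 2 = (a ^+ 2 - l) - ((b ^+ 2 - l) + 2%:R * (b * (a - b))) by ring.
    apply: le_lt_trans (absvD _ _ _) _; rewrite gt_max wal absvN /=.
    apply: le_lt_trans (absvD _ _ _) _; rewrite gt_max wbl /= absvM.
    apply: le_lt_trans w2; rewrite ler_piMr ?absv_ge0 // absvM mulr_ile1 ?absv_ge0 //.
    exact: absvB_le1.
  by rewrite absvX expr_lt1 ?absv_ge0.
- by move: wl'; rewrite ltNge wl.
- by move: wl; rewrite ltNge wl'.
- by case: h1.
Qed.

(** On the curve with parameter z the point (z, 0) has order 2. *)
Lemma own_parameter (z : Q) : z != 0 -> z != 1 -> torsion_params (embed z) (embed z).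
Proof.
move=> z0 z1; split; rewrite ?fmorph_eq0 ?fmorph_eq1 //.
exists 0; split; first by rewrite /= subrr mulr0 expr0n.
by exists 2%N; split=> //; rewrite /legendre_mul /= oppr0 !eqxx.
Qed.

Lemma simultaneous_torsionE : T = embed @`
  [set x | x = a /\ torsion_abscissa a b \/ x = b /\ torsion_abscissa b a].
Proof.
apply/seteqP; split=> [l hl|_ [x hx <-]].
  have [l' lE] : exists l' : Q, l = embed l' by apply: torsion_params_algebraic hl.1.
  exists l' => //; rewrite lE in hl *; case: (common_parameter hl) => e; rewrite e in hl *.
    by left; split=> //; case: hl => _ [_ _ /torsion_abscissa_embed].
  by right; split=> //; case: hl => [[_ _ /torsion_abscissa_embed]].
case: hx => -[-> /torsion_abscissa_embed tx].
  by split; [exact: own_parameter | split=> //; rewrite ?fmorph_eq0 ?fmorph_eq1].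
by split; [split=> //; rewrite ?fmorph_eq0 ?fmorph_eq1 | exact: own_parameter].
Qed.

(** If x is a torsion abscissa, then it is integral together with l, so every word
    outputs an integral number, and 1/2 is not integral. *)
Lemma halts_decide_torsion (l x : Q) : (l = a /\ x = b) \/ (l = b /\ x = a) ->
  forall s, s 3%N = l -> s 4%N = x -> halts decide s (decided l x).
Proof.
move=> lx s s3 s4; have [h1 _] := sep_red lx.
have [l0 l1 x0 x1 xl] : [/\ l != 0, l != 1, x != 0, x != 1 & x != l].
  by case: lx => -[-> ->]; split=> //; rewrite eq_sym.
have [y hP y0] := curve_point x0 x1 xl.
have [K K0 hK] := search_succeeds (embed_algebraic l) (embed_algebraic x) l0 l1 hP y0.
have := halts_decide Qbar_natr_eq0 s3 s4 (ex_intro2 _ _ K K0 hK).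
apply: halts_conseq => s'; apply: (verdict_decided Qbar_natr_eq0 l0 l1 hP y0).
move=> [y' tors] n half.
have [wx wl _] : [/\ w x <= 1, w l <= 1 & w (x ^+ 2 - l) < 1].
  have [//|[wx wl]] := torsion_congruence two_Q w2 l0 l1 x0 x1 xl tors.
  by case: h1.
have y'0 : y' != 0.
  by case: tors => /= hy _; rewrite -sqrf_eq0 hy !mulf_neq0 ?subr_eq0.
have := run_word_integral two_Q l0 l1 tors.1 y'0 wl
  (fun n X Y => @torsion_multiples_integral _ _ w l _ n X Y two_Q w2 l0 l1 wl tors) n.
set t := (run_word _ _ _ _).2.2 in half * => wt.
have := absv1 w; rewrite -half absvM => e.
have : w 2%:R * w t < 1 by apply: le_lt_trans w2; rewrite ler_piMr ?absv_ge0.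
by rewrite e ltxx.
Qed.

Lemma simultaneous_torsion_computed : computes_set torsion_program a b
  [set x | x = a /\ torsion_abscissa a b \/ x = b /\ torsion_abscissa b a].
Proof.
apply: (torsion_program_correct Qbar_natr_eq0).
  by apply: halts_decide_torsion; left.
by apply: halts_decide_torsion; right.
Qed.
End TwoAbscissae.
End Qbar.

Theorem corollary4 (R : realType)
    (Q2 : fieldType) (v : absolute_value R Q2)
    (Q2bar : closedFieldType) (j : {rmorphism Q2 -> Q2bar})
    (w : absolute_value R Q2bar) (i : {rmorphism Qbar R -> Q2bar}) :
  is_Qp 2 v -> is_Qp_closure v j w ->
  let T2 (a b : Qbar R) := simultaneous_torsion (Qval a) (Qval b) in
  let admissible (a b : Qbar R) :=
    [/\ a != 0, a != 1, b != 0, b != 1 & reduction w (i a) <> reduction w (i b)] in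
  (forall a b : Qbar R, admissible a b ->
     T2 a b `<=` [set Qval a; Qval b] /\ finite_set (T2 a b)) /\
  (exists c : cmd, forall a b : Qbar R, admissible a b ->
     exists A : set (Qbar R), T2 a b = @Qval R @` A /\ computes_set c a b A).
Proof.
move=> hv [_ hw] T2 admissible; pose u := pullback_absv w i.
have u2 : u 2%:R < 1.
  rewrite /= rmorph_nat -(rmorph_nat j) hw (is_Qp_absv_p _ hv) //.
  by rewrite invf_lt1 ?ltr1n.
have sep a b : admissible a b -> forall x y, (x = a /\ y = b) \/ (x = b /\ y = a) ->
    ~ (1 < u x /\ 1 < u y) /\ ~ [/\ u x <= 1, u y <= 1 & u (x - y) < 1].
  move=> [_ _ _ _ nred] x y xy.
  have nred' : reduction w (i x) <> reduction w (i y).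
    by case: xy => -[-> ->] //; exact: nesym.
  split=> [[hx hy]|[hx hy hxy]]; apply: nred'; first by rewrite !reduction_infinity.
  by apply: reduction_eq => //; rewrite -rmorphB.
split=> [a b hab|].
  have [a0 a1 b0 b1 _] := hab.
  have sub : T2 a b `<=` [set Qval a; Qval b].
    rewrite /T2 -[Qval a]/(embed R a) -[Qval b]/(embed R b).
    rewrite (simultaneous_torsionE u2 a0 a1 b0 b1 (sep a b hab)).
    by move=> _ [x [[-> _]|[-> _]] <-]; [left|right].
  by split=> //; apply: sub_finite_set sub _; exact: finite_set2.
exists torsion_program => a b hab; have [a0 a1 b0 b1 _] := hab.
exists [set x | x = a /\ torsion_abscissa a b \/ x = b /\ torsion_abscissa b a]; split.
  exact: (simultaneous_torsionE u2 a0 a1 b0 b1 (sep a b hab)).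
exact: (simultaneous_torsion_computed u2 a0 a1 b0 b1 (sep a b hab)).
Qed.
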